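(* Let $k\geq 8$ be an integer. There exists $n_0=n_0(k)$ such that for every $n\geq n_0$, every graph $G$ of order $n$ with $\mu(G)\geq \mu(S_{n,k})$ contains every tree $T\in\mathcal{T}^{\ast}$ as a subgraph, where $\mathcal{T}^{\ast}$ is the set of all trees $T$ of order $2k+3$ and diameter at most four with $p'(T)\leq k-1$.
   Context: $\mu(G)$ denotes the spectral radius of the adjacency matrix of $G$. $S_{n,k}=K_k\vee\overline{K_{n-k}}$ (every vertex of a $K_k$ joined to every vertex of an independent set of size $n-k$). A tree of diameter at most four is rooted at its center; if it has two adjacent centers, the root is the center $v$ for which $T-v$ has the largest number of components. Each component of $T$ minus its root is a star $K_{1,m}$ with $m\geq 0$ ($K_{1,0}=K_1$ being trivial); $p'(T)$ is the number of nontrivial (i.e. $m\geq 1$) such star components. *)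

(* Defs.v *)
From HB Require Import structures.
From mathcomp Require Import all_boot all_order all_algebra.
From mathcomp Require Import complex reals.

Set Implicit Arguments.
Unset Strict Implicit.
Unset Printing Implicit Defensive.

Import Order.TTheory GRing.Theory Num.Theory.

Local Open Scope ring_scope.

Record sgraph := SGraph {
  vertex :> finType;
  adj : rel vertex;
  adj_sym : symmetric adj;
  adj_irrefl : irreflexive adj
}.

Section Families.

Lemma complete_sym n : symmetric [rel i j : 'I_n | i != j].
Proof. by move=> i j /=; rewrite eq_sym. Qed.

Lemma complete_irrefl n : irreflexive [rel i j : 'I_n | i != j].
Proof. by move=> i /=; rewrite eqxx. Qed.

Definition complete_graph (n : nat) : sgraph :=
  SGraph (@complete_sym n) (@complete_irrefl n).

Lemma gcompl_sym (G : sgraph) :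
  symmetric [rel x y : G | (x != y) && ~~ adj x y].
Proof. by move=> x y /=; rewrite eq_sym adj_sym. Qed.

Lemma gcompl_irrefl (G : sgraph) :
  irreflexive [rel x y : G | (x != y) && ~~ adj x y].
Proof. by move=> x /=; rewrite eqxx. Qed.

Definition gcompl (G : sgraph) : sgraph :=
  SGraph (@gcompl_sym G) (@gcompl_irrefl G).

Definition gjoin_adj (G H : sgraph) : rel (G + H)%type := fun u v =>
  match u, v with
  | inl x, inl y => adj x y
  | inr x, inr y => adj x y
  | _, _ => true
  end.

Lemma gjoin_sym (G H : sgraph) : symmetric (@gjoin_adj G H).
Proof. by move=> [x|x] [y|y] //=; rewrite adj_sym. Qed.

Lemma gjoin_irrefl (G H : sgraph) : irreflexive (@gjoin_adj G H).
Proof. by move=> [x|x] /=; rewrite adj_irrefl. Qed.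

Definition gjoin (G H : sgraph) : sgraph :=
  SGraph (@gjoin_sym G H) (@gjoin_irrefl G H).

(* Has order n only when k <= n, since n - k is truncated. *)
Definition Snk (n k : nat) : sgraph :=
  gjoin (complete_graph k) (gcompl (complete_graph (n - k))).

Lemma delete_sym (G : sgraph) (v : G) :
  symmetric [rel x y : {x : G | x != v} | adj (val x) (val y)].
Proof. by move=> x y /=; rewrite adj_sym. Qed.

Lemma delete_irrefl (G : sgraph) (v : G) :
  irreflexive [rel x y : {x : G | x != v} | adj (val x) (val y)].
Proof. by move=> x /=; rewrite adj_irrefl. Qed.

Definition delete_vertex (G : sgraph) (v : G) : sgraph :=
  SGraph (@delete_sym G v) (@delete_irrefl G v).

End Families.

Section Spectrum.

Variable R : realType.

Definition eigenvalues (n : nat) (A : 'M[R[i]]_n) : seq R[i] :=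
  sval (closed_field_poly_normal (char_poly A)).

Definition spectral_radius (n : nat) (A : 'M[R[i]]_n) : R :=
  \big[Num.max/0]_(z <- eigenvalues A) complex.Re `|z|.

Definition adjmx (G : sgraph) : 'M[R[i]]_#|G| :=
  \matrix_(i, j) (adj (enum_val i) (enum_val j))%:R.

Definition mu (G : sgraph) : R := spectral_radius (adjmx G).

End Spectrum.

Section Graphs.

(* Not necessarily induced. *)
Definition has_subgraph (G H : sgraph) : Prop :=
  exists2 f : H -> G, injective f & forall x y : H, adj x y -> adj (f x) (f y).

Definition is_connected (G : sgraph) : Prop :=
  (0 < #|G|)%N /\ forall x y : G, connect (@adj G) x y.

Definition acyclic (G : sgraph) : Prop :=
  forall c : seq G, (2 < size c)%N -> ~ ucycle (@adj G) c.

Definition is_tree (G : sgraph) : Prop := is_connected G /\ acyclic G.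

Definition walk (G : sgraph) (m : nat) (x y : G) : bool :=
  [exists p : m.-tuple G, path (@adj G) x p && (last x p == y)].

(* The least length of a walk from x to y. Lengths below #|G| suffice; the
   value is #|G| when y is not reachable from x. *)
Definition gdist (G : sgraph) (x y : G) : nat :=
  find (fun m => walk m x y) (iota 0 #|G|).

Definition ecc (G : sgraph) (x : G) : nat := \max_(y : G) gdist x y.

Definition diameter (G : sgraph) : nat := \max_(x : G) ecc x.

Definition is_center (G : sgraph) (v : G) : bool :=
  [forall u : G, (ecc v <= ecc u)%N].

Definition components (G : sgraph) : {set {set G}} :=
  equivalence_partition (connect (@adj G)) [set: G].

(* C induces a star K_{1,m} with m = #|C| - 1 >= 0. *)
Definition is_star (G : sgraph) (C : {set G}) : bool :=
  [exists c in C, forall x in C, forall y in C,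
     adj x y == ((x == c) (+) (y == c))].

(* If a tree has a single center, the second condition is void. If it has two
   centers giving equally many components, either of them is a root. *)
Definition is_root (T : sgraph) (v : T) : Prop :=
  is_center v /\
  forall u : T, is_center u ->
    (#|components (delete_vertex u)| <= #|components (delete_vertex v)|)%N.

Definition nontrivial_stars (T : sgraph) (v : T) : nat :=
  #|[set C in components (delete_vertex v) | is_star C & (1 < #|C|)%N]|.

(* Two roots can only occur in a double star with equal sides, which an
   automorphism swaps, so the choice of v does not matter. *)
Definition in_Tstar (k : nat) (T : sgraph) : Prop :=
  [/\ is_tree T, #|T| = (2 * k + 3)%N, (diameter T <= 4)%N &
      exists2 v : T, is_root v & (nontrivial_stars v <= k - 1)%N].

End Graphs.

(* Main.v *)
(* Let A be the adjacency matrix of G and x the vector of moduli of an eigenvector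
   for an eigenvalue of modulus mu(G), so that A x >= mu(G) x. As mu(S_{n,k}) is
   at least the positive root of t^2 - (k-1) t = k (n-k), summing the entries of
   (A^2 - (k-1) A) x shows that some vertex u satisfies
     sum_{v ~ u} d(v) >= k (n-k) + (k-1) d(u).
   If d(u) is bounded, this forces either k universal vertices adjacent to u, or
   k neighbours of u with many common neighbours, u having a further neighbour;
   in both cases T embeds, because one bipartition class of T has at most k+1
   vertices. If d(u) is large, either u has k-1 neighbours of large degree, which
   serve as star centers, or linearly many neighbours of u have at least 2k-1-h
   neighbours, h < k-1 being the number of neighbours of large degree; a sunflower
   among these neighbourhoods then provides the stars of T. *)
Require Import Defs.
From mathcomp Require Import all_boot all_order all_algebra.
From mathcomp Require Import complex reals.
From mathcomp Require Import zify lra.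

Set Implicit Arguments.
Unset Strict Implicit.
Unset Printing Implicit Defensive.

Local Open Scope nat_scope.

(** * Greedy embeddings and sunflowers *)

(** Vertices receive their values one at a time. Each choice uses up at most one element of every
    candidate set and lowers the number of waiting vertices by one, so the counting hypothesis
    survives. *)
Lemma greedy_extension (T V : finType) (D D' : {set T}) (f : T -> V)
    (C : T -> {set V}) :
  D \subset D' -> {in D &, injective f} ->
  {in D' :\: D, forall x, #|D' :\: D| <= #|C x :\: f @: D|} ->
  exists g : T -> V, [/\ {in D, g =1 f}, {in D' &, injective g} &
    {in D' :\: D, forall x, g x \in C x :\: f @: D}].
Proof.
move: {2}#|D' :\: D| (erefl #|D' :\: D|) => m.
elim: m D f C => [|m IH] D f C card_m subD injf candC.
  have eqD : D' = D.
    apply/eqP; rewrite eqEsubset subD andbT -setD_eq0 -cards_eq0 card_m //.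
  by subst D'; exists f; split=> // x; rewrite setDv inE.
have /card_gt0P[x xD'] : 0 < #|D' :\: D| by rewrite card_m.
have /card_gt0P[v vC] : 0 < #|C x :\: f @: D|.
  by apply: leq_trans (candC x xD'); rewrite card_m.
have [xnD xinD'] : x \notin D /\ x \in D' by move: xD'; rewrite inE => /andP.
have [vnf vinC] : v \notin f @: D /\ v \in C x.
  by move: vC; rewrite inE => /andP.
pose f1 y := if y == x then v else f y.
have f1D : {in D, f1 =1 f}.
  by move=> y yD; rewrite /f1; case: eqP => // yx; rewrite -yx yD in xnD.
have f1x : f1 x = v by rewrite /f1 eqxx.
have imf1 : f1 @: (x |: D) = v |: f @: D.
  by rewrite imsetU1 f1x; congr (_ |: _); apply: eq_in_imset.
have cD : D' :\: (x |: D) = (D' :\: D) :\ x.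
  by apply/setP=> y; rewrite !inE negb_or andbA.
have cardD1 : #|D' :\: (x |: D)| = m.
  by apply: succn_inj; rewrite -card_m cD (cardsD1 x (D' :\: D)) xD'.
have [||y yD1|g [gf ginj gC]] := IH (x |: D) f1 C cardD1.
- by rewrite subUset sub1set xinD' subD.
- move=> a b; rewrite !in_setU1.
  move=> /predU1P[->|aD] /predU1P[->|bD] //.
  + by rewrite f1x f1D // => E; move: vnf; rewrite E imset_f.
  + by rewrite f1x f1D // => E; move: vnf; rewrite -E imset_f.
  + by rewrite !f1D //; apply: injf.
- rewrite cardD1 imf1; rewrite cD in yD1.
  have yD : y \in D' :\: D by move: yD1; rewrite in_setD1 => /andP[].
  have := candC y yD; rewrite card_m => H.
  have -> : C y :\: (v |: f @: D) = (C y :\: f @: D) :\ v.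
    by apply/setP=> z; rewrite !inE negb_or andbA.
  rewrite -ltnS; apply: leq_trans H _.
  by rewrite (cardsD1 v (C y :\: f @: D)); case: (v \in _).
exists g; split=> //.
- by move=> y yD; rewrite gf ?f1D // in_setU1 yD orbT.
move=> y yD; have [->|yx] := eqVneq y x.
  by rewrite gf ?f1x ?setU11.
have /gC : y \in D' :\: (x |: D) by rewrite cD in_setD1 yx.
by rewrite imf1 !inE negb_or => /andP[/andP[_ ->] ->].
Qed.

(** The values on [D] occupy at most [#|D|] candidates, which leaves at least [#|D' :\: D|] in every
    set. *)
Lemma greedy_extension_large (T V : finType) (D D' : {set T}) (f : T -> V)
    (C : T -> {set V}) :
  D \subset D' -> {in D &, injective f} ->
  {in D' :\: D, forall x, #|D'| <= #|C x|} ->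
  exists g : T -> V, [/\ {in D, g =1 f}, {in D' &, injective g} &
    {in D' :\: D, forall x, g x \in C x}].
Proof.
move=> subD injf candC.
have [|g [gf ginj gC]] := greedy_extension (C := C) subD injf; last first.
  by exists g; split=> // x /gC; rewrite inE => /andP[].
move=> x /candC H.
rewrite cardsD (setIidPr subD).
have := leq_imset_card f D; have := cardsID (f @: D) (C x).
have := subset_leq_card (subsetIr (C x) (f @: D)); lia.
Qed.

Lemma injection_of_card (T V : finType) (v0 : V) (X : {set T}) (S : {set V}) :
  #|X| <= #|S| ->
  exists f : T -> V, {in X &, injective f} /\ {in X, forall x, f x \in S}.
Proof.
move=> leXS.
have [||x _|g [_ ginj gC]] :=
  @greedy_extension_large T V set0 X (fun=> v0) (fun=> S).
- exact: sub0set.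
- by move=> x y; rewrite inE.
- by [].
by exists g; split=> // x xX; apply: gC; rewrite setD0.
Qed.

Definition pairwise_disjoint_on (I V : finType) (J : {set I})
  (P : I -> {set V}) :=
  {in J &, forall i j, i != j -> [disjoint P i & P j]}.

(** Double counting of the pairs [(i, z)] with [z] in both [P i] and [U]: every [i] in [J] gives at
    least one. *)
Lemma meeting_family_card (I V : finType) (J : {set I}) (P : I -> {set V})
    (U : {set V}) :
  {in J, forall i, ~~ [disjoint P i & U]} ->
  #|J| <= \sum_(z in U) #|[set i in J | z \in P i]|.
Proof.
move=> meetU.
apply: (@leq_trans (\sum_(i in J) #|P i :&: U|)).
  rewrite -sum1_card leq_sum // => i /meetU.
  by rewrite -setI_eq0 lt0n cards_eq0.
under eq_bigr do rewrite -sum1_card big_mkcond /=.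
rewrite exchange_big /= [leqRHS]big_mkcond /=.
apply: leq_sum => z _; case: ifP => zU; last first.
  by rewrite big1 // => i _; rewrite inE zU andbF.
under eq_bigr do rewrite inE zU andbT.
rewrite -big_mkcondr sum1_card; apply: subset_leq_card.
by apply/subsetP=> i; rewrite !inE.
Qed.

(** A point of [U] lies in at most one of the disjoint sets, so fewer points than sets cannot meet
    them all. *)
Lemma disjoint_family_avoid (I V : finType) (J : {set I}) (P : I -> {set V})
    (U : {set V}) :
  pairwise_disjoint_on J P -> #|U| < #|J| ->
  exists2 i, i \in J & [disjoint P i & U].
Proof.
move=> disjP ltUJ.
apply/exists_inP; apply: contraTT ltUJ => /exists_inPn meetU; rewrite -leqNgt.
apply: leq_trans (meeting_family_card meetU) _.
rewrite -[leqRHS]sum1_card; apply: leq_sum => z _.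
apply/card_le1_eqP => i j; rewrite !inE => /andP[iJ zi] /andP[jJ zj].
apply/eqP; apply: contraT; rewrite eq_sym => nij.
by have /disjoint_setI0/setP/(_ z) := disjP i j iJ jJ nij; rewrite !inE zi zj.
Qed.

(** Induction on the size bound. A maximal disjoint subfamily is either large enough, with empty
    kernel, or its union is a bounded set met by all other members; a popular point of this union is
    removed from the sets and later joins the kernel. The family is indexed, so sets may repeat and
    petals may be empty. *)
Lemma sunflower (r q : nat) : exists N : nat,
  forall (I V : finType) (L : {set I}) (F : I -> {set V}),
  {in L, forall i, #|F i| <= r} -> N <= #|L| ->
  exists (J : {set I}) (K : {set V}), [/\ J \subset L, q <= #|J|,
    {in J, forall i, K \subset F i} &
    pairwise_disjoint_on J (fun i => F i :\: K)].
Proof.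
elim: r => [|r [N IH]].
  exists q => I V L F F0 qL; exists L, set0; split=> // i; first by rewrite sub0set.
  move=> j iL jL _; have := F0 i iL; rewrite leqn0 cards_eq0 => /eqP->.
  by rewrite set0D -setI_eq0 set0I.
(* The first [q] bounds the maximal subfamily. Its union has at most [q * r.+1] points; if each lay
   in fewer than [N] sets, [L] would be too small. *)
exists (q + q * r.+1 * N) => I V L F Fr NL.
pose ok (J : {set I}) := (J \subset L) &&
  [forall i in J, forall j in J, (i != j) ==> [disjoint F i & F j]].
have ok0 : ok set0 by rewrite /ok sub0set; apply/forall_inP=> i; rewrite inE.
case: (arg_maxnP (fun J : {set I} => #|J|) ok0) => J /andP[JL /forall_inP Jd] Jmax.
have JD : {in J &, forall i j, i != j -> [disjoint F i & F j]}.
  by move=> i j iJ jJ; move/forall_inP: (Jd i iJ) => /(_ j jJ)/implyP.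
have [qJ|ltJq] := leqP q #|J|.
  exists J, set0; split=> // [i _|i j iJ jJ nij]; first exact: sub0set.
  by rewrite !setD0; apply: JD.
pose U := \bigcup_(i in J) F i.
have cardU : #|U| <= q * r.+1.
  apply: (@leq_trans (\sum_(i in J) r.+1)).
    rewrite /U; elim/big_ind2: _ => [|a A b B lea leb|i iJ].
    - by rewrite cards0.
    - by apply: leq_trans (leq_card_setU A B).1 (leq_add lea leb).
    - by apply: Fr; apply: (subsetP JL).
  by rewrite sum_nat_const leq_mul2r (ltnW ltJq) orbT.
have meetU : {in L :\: J, forall i, ~~ [disjoint F i & U]}.
  move=> i; rewrite inE => /andP[iJ iL]; rewrite -setI_eq0; apply/negP=> FU.
  have dF j : j \in J -> [disjoint F i & F j].
    move=> jJ; rewrite -setI_eq0 -subset0 -(eqP FU); apply: setIS.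
    exact: bigcup_sup.
  suff /Jmax : ok (i |: J) by rewrite /= cardsU1 iJ add1n ltnn.
  rewrite /ok subUset sub1set iL JL /=.
  apply/forall_inP=> a aJ; apply/forall_inP=> b bJ; apply/implyP=> nab.
  move: aJ bJ nab; rewrite !in_setU1.
  move=> /predU1P[->|aJ] /predU1P[->|bJ]; rewrite ?eqxx // => nab.
  - exact: dF.
  - by rewrite disjoint_sym; apply: dF.
  - exact: JD.
have [z zU Nz] : exists2 z, z \in U & N <= #|[set i in L | z \in F i]|.
  apply/exists_inP; apply: contraTT NL => /exists_inPn small.
  rewrite -ltnNge.
  have H : #|L :\: J| <= \sum_(z in U) #|[set i in L | z \in F i]|.
    apply: leq_trans (meeting_family_card meetU) _; apply: leq_sum => z _.
    apply: subset_leq_card; apply/subsetP=> i.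
    by rewrite !inE => /andP[/andP[_ ->] ->].
  have H2 : \sum_(z in U) #|[set i in L | z \in F i]| <= #|U| * N.
    rewrite -sum_nat_const; apply: leq_sum => z /small; rewrite -ltnNge; exact: ltnW.
  have := cardsID J L; rewrite (setIidPr JL).
  have : #|U| * N <= q * r.+1 * N by rewrite leq_mul2r cardU orbT.
  lia.
pose Lz := [set i in L | z \in F i].
have [i|J' [K [J'L qJ' KF disj]]] := IH I V Lz (fun i => F i :\ z) _ Nz.
  by rewrite inE => /andP[/Fr + zF]; rewrite (cardsD1 z (F i)) zF.
exists J', (z |: K); split=> //.
- by apply: subset_trans J'L _; apply/subsetP=> i; rewrite inE => /andP[].
- move=> i iJ; have := subsetP J'L i iJ; rewrite inE => /andP[_ zF].
  rewrite subUset sub1set zF /=; apply: subset_trans (KF i iJ) _.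
  exact: subD1set.
move=> i j iJ jJ nij; have := disj i j iJ jJ nij.
rewrite (_ : F i :\: (z |: K) = (F i :\ z) :\: K); last by rewrite setDDl.
by rewrite (_ : F j :\: (z |: K) = (F j :\ z) :\: K) // setDDl.
Qed.

(** * Embedding trees of depth two *)

Definition nbr (G : sgraph) (x : G) : {set G} := [set y | adj x y].

Definition common_nbr (G : sgraph) (S : {set G}) : {set G} :=
  [set y | [forall s in S, adj s y]].

Lemma common_nbrP (G : sgraph) (S : {set G}) y s :
  y \in common_nbr S -> s \in S -> adj s y.
Proof. by rewrite inE => /forall_inP; apply. Qed.

(* A tree of depth at most two is encoded by its parent function [pi], with
   the root as its own parent. *)
Section ParentFunction.

Variables (T : finType) (r : T) (pi : T -> T).

Definition parent_depth2 : Prop := pi r = r /\ forall x, pi (pi x) = r.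

Definition children : {set T} := [set x | (x != r) && (pi x == r)].

Definition offspring (c : T) : {set T} := [set x | pi x == c].

(** These are the centers of the nontrivial stars left after deleting the root. *)
Definition centers : {set T} := [set c in children | offspring c != set0].

Definition embeds (G : sgraph) : Prop :=
  exists2 f : T -> G, injective f & forall x, x != r -> adj (f x) (f (pi x)).

Hypothesis piP : parent_depth2.

Lemma pi_children x : (pi x \in children) = (pi x != r).
Proof. by rewrite inE piP.2 eqxx andbT. Qed.

Lemma pi_centers x : (pi x \in centers) = (pi x != r).
Proof.
rewrite inE pi_children; case: (pi x != r) => //=.
by apply/set0Pn; exists x; rewrite inE.
Qed.

Lemma children_alternate x : x != r -> (x \in children) (+) (pi x \in children).
Proof. by move=> xr; rewrite pi_children inE xr; case: (pi x == r). Qed.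

Lemma card_children : #|children| < #|T|.
Proof.
rewrite -cardsT; apply: proper_card; rewrite properEneq subsetT andbT.
by apply/eqP=> /setP/(_ r); rewrite !inE eqxx.
Qed.

(** The vertices at depth two are grouped by their parent, which lies in [centers]. *)
Lemma card_depth2 :
  #|T| = 1 + #|children| + \sum_(c in centers) #|offspring c|.
Proof.
rewrite -cardsT -(cardsID (r |: children)) setTI cardsU1 inE eqxx /=.
congr (_ + _); rewrite -sum1_card (partition_big pi (mem centers)) /=; last first.
  move=> x; rewrite in_setD in_setT andbT in_setU1 negb_or inE.
  by move=> /andP[xr]; rewrite xr pi_centers.
apply: eq_bigr => c; rewrite !inE => /andP[/andP[cr _] _].
rewrite -sum1_card; apply: eq_bigl => x; rewrite !inE andbT.
case: (pi x =P c) => [E|]; last by rewrite andbF.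
rewrite E (negbTE cr) andbF orbF andbT; apply: contra cr => /eqP xr.
by rewrite -E xr piP.1 eqxx.
Qed.

Variable G : sgraph.

(** All values of [pi] lie in [r |: centers], so the vertices outside [D] are leaves with embedded
    parents and can be added greedily. *)
Lemma embeds_of_core (D : {set T}) (f : T -> G) :
  r |: centers \subset D -> {in D &, injective f} ->
  {in D, forall x, x != r -> adj (f x) (f (pi x))} ->
  {in ~: D, forall x, #|T| <= #|nbr (f (pi x))|} -> embeds G.
Proof.
move=> coreD injf adjf degf.
have piD x : pi x \in D.
  apply: (subsetP coreD); rewrite in_setU1 pi_centers.
  by case: (pi x == r).
have [||x xD|g [gf ginj gC]] :=
  @greedy_extension_large T G D setT f (fun x => nbr (f (pi x))).
- exact: subsetT.
- by [].
- by rewrite cardsT; apply: degf; move: xD; rewrite setTD.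
exists g; first by move=> x y; apply: ginj; rewrite inE.
move=> x xr; rewrite (gf (pi x)) //.
have [xD|xD] := boolP (x \in D); first by rewrite gf // adjf.
have /gC : x \in setT :\: D by rewrite setTD inE.
by rewrite inE adj_sym.
Qed.

(** The children of the root are placed before the deeper leaves, so the image of the root needs
    only [#|children|] neighbours. This matters when the root goes to a vertex of small degree. *)
Lemma embeds_of_centers (f : T -> G) :
  {in r |: centers &, injective f} ->
  {in centers, forall c, adj (f r) (f c)} ->
  #|children| <= #|nbr (f r)| ->
  {in centers, forall c, #|T| <= #|nbr (f c)|} -> embeds G.
Proof.
move=> injf adjf degr degc.
have subc : centers \subset children by apply/subsetP=> c; rewrite inE => /andP[].
have rnc : r \notin children by rewrite inE eqxx.
have [||x xD|g [gf ginj gC]] :=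
  @greedy_extension T G (r |: centers) (r |: children) f (fun=> nbr (f r)).
- exact: setUS.
- by [].
- have -> : (r |: children) :\: (r |: centers) = children :\: centers.
    apply/setP=> y; rewrite !in_setD !in_setU1 negb_or.
    by have [->|_] := eqVneq y r; rewrite //= (negbTE rnc) andbF.
  rewrite cardsD (setIidPr subc) imsetU1.
  have -> : nbr (f r) :\: (f r |: f @: centers) = nbr (f r) :\: f @: centers.
    apply/setP=> y; rewrite !in_setD in_setU1 negb_or.
    by have [->|_] := eqVneq y (f r); rewrite //= !inE adj_irrefl andbF.
  rewrite cardsD; have := leq_imset_card f centers.
  have := subset_leq_card (subsetIr (nbr (f r)) (f @: centers)); lia.
have gr : g r = f r by rewrite gf // setU11.
have adjg x : x \in children -> adj (g r) (g x).
  move=> xc; rewrite gr; have [xP|xP] := boolP (x \in centers).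
    by rewrite gf ?adjf // in_setU1 xP orbT.
  suff /gC : x \in (r |: children) :\: (r |: centers) by rewrite !inE => /andP[].
  rewrite in_setD !in_setU1 xc orbT andbT negb_or xP andbT.
  by apply: contraNneq rnc => <-.
apply: (@embeds_of_core (r |: children) g) => //; first exact: setUS.
  move=> x; rewrite in_setU1 => /predU1P[->|xc] xr; first by rewrite eqxx in xr.
  have /eqP-> : pi x == r by move: xc; rewrite inE => /andP[].
  by rewrite adj_sym adjg.
move=> x; rewrite in_setC in_setU1 negb_or inE => /andP[xr]; rewrite xr /= => pxr.
by rewrite gf ?degc // ?in_setU1 pi_centers pxr ?orbT.
Qed.

Lemma embeds_bipartite (X D : {set T}) (f : T -> G) (S : {set G}) :
  (forall x, x != r -> (x \in X) (+) (pi x \in X)) ->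
  X \subset D -> {in D &, injective f} ->
  {in D, forall x, x != r -> pi x \in D -> adj (f x) (f (pi x))} ->
  {in D, forall x, x != r -> pi x \notin D -> f x \in S} ->
  (forall x, x != r -> x \notin D -> f (pi x) \in S) ->
  #|T| <= #|common_nbr S| -> embeds G.
Proof.
move=> alt XD injf adjD fS fpS leC.
have [||x xD|g [gf ginj gC]] :=
  @greedy_extension_large T G D setT f (fun=> common_nbr S).
- exact: subsetT.
- by [].
- by rewrite cardsT.
exists g; first by move=> x y; apply: ginj; rewrite inE.
have {}gC x : x \notin D -> g x \in common_nbr S.
  by move=> xD; apply: gC; rewrite setTD inE.
move=> x xr; have [xD|xD] := boolP (x \in D).
  have [pD|pD] := boolP (pi x \in D); first by rewrite !gf ?adjD.
  by rewrite gf //; apply: common_nbrP (gC _ pD) _; apply: fS.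
have pD : pi x \in D.
  apply: (subsetP XD); have := alt x xr.
  by rewrite (negbTE (contra (subsetP XD x) xD)).
by rewrite (gf _ pD) adj_sym; apply: common_nbrP (gC _ xD) _; apply: fpS.
Qed.

Lemma embeds_small_class (X : {set T}) (S : {set G}) (u : G) :
  (forall x, x != r -> (x \in X) (+) (pi x \in X)) ->
  #|X| <= #|S| -> #|T| <= #|common_nbr S| -> embeds G.
Proof.
move=> alt leXS leC.
have [f [injf fS]] := injection_of_card u leXS.
apply: (embeds_bipartite (D := X) (f := f) alt) leC => //.
- by move=> x xX xr pX; move: (alt x xr); rewrite xX pX.
- by move=> x xX _ _; apply: fS.
- by move=> x xr xX; apply: fS; move: (alt x xr); rewrite (negbTE xX).
Qed.

(* One vertex of [X] more than [S] can hold: the leaf [x'] goes to [s'], and its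
   only neighbour [y0] to [u], which sees [s'] and all of [S]. *)
Lemma embeds_leaf_class (X : {set T}) (x' y0 : T) (S : {set G}) (u s' : G) :
  (forall x, x != r -> (x \in X) (+) (pi x \in X)) ->
  x' \in X -> y0 \notin X ->
  (x' != r -> pi x' = y0) -> (forall x, x != r -> pi x = x' -> x = y0) ->
  #|X| <= #|S|.+1 -> #|T| <= #|common_nbr S| ->
  u \in common_nbr S -> s' \in nbr u -> s' \notin S -> embeds G.
Proof.
move=> alt x'X y0X px' cx' leXS leC uC s'u s'S.
have leX' : #|X :\ x'| <= #|S| by move: leXS; rewrite (cardsD1 x' X) x'X.
have [f1 [inj1 f1S]] := injection_of_card u leX'.
have x'y0 : x' != y0 by apply: contraNneq y0X => <-.
have uS : u \notin S by apply/negP=> /(common_nbrP uC); rewrite adj_irrefl.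
have us' : adj u s' by rewrite inE in s'u.
have us'N : u != s' by apply: contraTneq us' => ->; rewrite adj_irrefl.
pose f x := if x == x' then s' else if x == y0 then u else f1 x.
have fx' : f x' = s' by rewrite /f eqxx.
have fy0 : f y0 = u by rewrite /f eq_sym (negbTE x'y0) eqxx.
have fX x : x \in X -> x != x' -> f x = f1 x.
  move=> xX xx'; rewrite /f (negbTE xx'); case: eqP => // E.
  by rewrite -E xX in y0X.
have fXS x : x \in X -> x != x' -> f x \in S.
  by move=> xX xx'; rewrite fX // f1S // in_setD1 xx'.
have key : forall a b, a \in X -> b \in X -> f a = f b -> a = b.
  move=> a b aX bX; have [->|ax] := eqVneq a x'; have [->|bx] := eqVneq b x' => //.
  - by move=> E; move: (fXS b bX bx); rewrite -E fx' (negbTE s'S).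
  - by move=> E; move: (fXS a aX ax); rewrite E fx' (negbTE s'S).
  by rewrite !fX // => /inj1-> //; rewrite in_setD1 ?ax ?bx.
have keyu : forall a, a \in X -> f a != u.
  move=> a aX; have [->|ax] := eqVneq a x'; first by rewrite fx' eq_sym.
  by apply: contraNneq uS => <-; apply: fXS.
apply: (embeds_bipartite (D := y0 |: X) (f := f) alt) leC.
- exact: subsetUr.
- move=> a b; rewrite !in_setU1 => /predU1P[->|aX] /predU1P[->|bX] //.
  + by move=> E; move: (keyu b bX); rewrite -E fy0 eqxx.
  + by move=> E; move: (keyu a aX); rewrite E fy0 eqxx.
  + exact: key.
- move=> x; rewrite !in_setU1 => /predU1P[->|xX] xr.
    move=> /predU1P[E|pX].
      by move: (alt _ xr); rewrite E (negbTE y0X).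
    rewrite fy0; have [->|px] := eqVneq (pi y0) x'; first by rewrite fx'.
    by rewrite adj_sym; apply: common_nbrP uC _; apply: fXS.
  move=> /predU1P[E|pX]; last by move: (alt _ xr); rewrite xX pX.
  rewrite E fy0; have [->|xx] := eqVneq x x'; first by rewrite fx' adj_sym.
  by apply: common_nbrP uC _; apply: fXS.
- move=> x; rewrite !in_setU1 negb_or => xD xr /andP[py pX].
  have xX : x \in X by move: (alt x xr); rewrite (negbTE pX) addbF.
  by apply: fXS => //; apply: contraNneq py => E; rewrite E px' // -E.
- move=> x xr; rewrite in_setU1 negb_or => /andP[xy xX].
  have pX : pi x \in X by move: (alt x xr); rewrite (negbTE xX).
  by apply: fXS => //; apply: contraNneq xy => /(cx' x xr) ->.
Qed.

(* The classes have sizes summing to [2k+3], so one of them has at most [k+1]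
   vertices; if it has exactly [k+1], it contains a leaf. *)
Lemma embeds_common_nbr k (S : {set G}) (u s' : G) :
  0 < k -> #|T| = 2 * k + 3 -> #|centers| <= k - 1 -> #|S| = k ->
  #|T| <= #|common_nbr S| ->
  u \in common_nbr S -> s' \in nbr u -> s' \notin S -> embeds G.
Proof.
move=> k0 cT cP cS leC uC s'u s'S.
have altA := children_alternate.
have altB x : x != r -> (x \in ~: children) (+) (pi x \in ~: children).
  by move/altA; rewrite !in_setC; do 2 case: (_ \in _).
have := cardsC children; rewrite cT => cAB.
have [leB|ltB] := leqP #|~: children| k.
  by apply: (embeds_small_class u altB) leC; rewrite cS.
have [leA|ltA] := leqP #|children| k.
  by apply: (embeds_small_class u altA) leC; rewrite cS.
have rB : r \in ~: children by rewrite !inE eqxx.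
have [eqB|neqB] := eqVneq #|~: children| k.+1.
  (* A vertex of [~: children] other than [r] has depth two, hence is a leaf. *)
  have [x] : exists x, x \in ~: children :\ r.
    by apply/card_gt0P; move: eqB; rewrite (cardsD1 r) rB; lia.
  rewrite !inE => /andP[xr]; rewrite xr /= => pxr.
  apply: (@embeds_leaf_class _ x (pi x) S u s' altB) => //.
  - by rewrite !inE xr.
  - by rewrite inE pi_children pxr.
  - by move=> y yr E; move: pxr; rewrite -E piP.2 eqxx.
  - by rewrite cS eqB.
(* Here [children] has exactly [k + 1] elements, of which at most [k - 1] are star centers, so some
   child of the root is a leaf. *)
have [x] : exists x, x \in children :\: centers.
  apply/card_gt0P; rewrite cardsD.
  by have := subset_leq_card (subsetIr children centers); lia.
rewrite in_setD => /andP[xP xA].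
apply: (@embeds_leaf_class _ x r S u s' altA) => //.
- by rewrite !inE eqxx.
- by move=> _; move: xA; rewrite inE => /andP[_ /eqP].
- move=> y yr E; move: xP; rewrite -E pi_centers E.
  by move: xA; rewrite inE => /andP[->].
- by rewrite cS; lia.
Qed.

End ParentFunction.

(** * Embeddings built around the root and the star centers *)

Section EmbeddingStars.

Variables (T : finType) (r : T) (pi : T -> T) (G : sgraph).
Hypothesis piP : parent_depth2 r pi.

Lemma embeds_centers_into (u : G) (S : {set G}) :
  #|centers r pi| <= #|S| -> S \subset nbr u ->
  #|children r pi| <= #|nbr u| ->
  {in S, forall s, #|T| <= #|nbr s|} -> embeds r pi G.
Proof.
move=> leS Su leu degS.
have [f [injf fS]] := injection_of_card u leS.
have rP : r \notin centers r pi by rewrite !inE eqxx.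
pose g x := if x == r then u else f x.
have gr : g r = u by rewrite /g eqxx.
have gP c : c \in centers r pi -> g c = f c.
  by move=> cP; rewrite /g; case: eqP => // E; rewrite E (negbTE rP) in cP.
have adjg c : c \in centers r pi -> adj u (g c).
  by move=> cP; rewrite gP //; have := subsetP Su _ (fS c cP); rewrite inE.
have neq c : c \in centers r pi -> g c != u.
  by move=> cP; apply: contraTneq (adjg c cP) => ->; rewrite adj_irrefl.
apply: (embeds_of_centers piP (f := g)).
- move=> a b; rewrite !in_setU1 => /predU1P[->|aP] /predU1P[->|bP] //.
  + by rewrite gr => E; move: (neq b bP); rewrite -E eqxx.
  + by rewrite gr => E; move: (neq a aP); rewrite E eqxx.
  + by rewrite !gP //; apply: injf.
- by move=> c cP; rewrite gr adjg.
- by rewrite gr.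
- by move=> c cP; rewrite gP // degS // fS.
Qed.

(** The small stars are placed one by one, each with its center at a member [v] of [J] and its
    leaves in the petal [P v]. The leaves of the root and of the centers in [big] come last,
    greedily, as their parents have degree at least [#|T|]. *)
Lemma embeds_stars (f0 : T -> G) (big : {set T}) (J : {set G})
    (P : G -> {set G}) (D : nat) :
  big \subset centers r pi ->
  {in r |: big &, injective f0} ->
  {in big, forall c, adj (f0 r) (f0 c)} ->
  {in r |: big, forall c, #|T| <= #|nbr (f0 c)|} ->
  J \subset nbr (f0 r) -> 2 * #|T| < #|J| ->
  pairwise_disjoint_on J P ->
  {in J, forall v, P v \subset nbr v /\ D <= #|P v|} ->
  {in centers r pi :\: big, forall c, #|offspring pi c| <= D} ->
  embeds r pi G.
Proof.
move=> bigP inj0 adj0 deg0 Jr cardJ disjP PJ small.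
(* The part embedded once the stars centred in [C] are placed: the root, [big], and [C] with its
   leaves. *)
pose dom (C : {set T}) := [set x | [|| x \in r |: big, x \in C | pi x \in C]].
have pi_center c : c \in centers r pi -> c != r /\ pi c = r.
  by rewrite !inE => /andP[/andP[? /eqP]].
have main m (C : {set T}) : #|C| = m -> C \subset centers r pi :\: big ->
    exists g : T -> G, [/\ {in r |: big, g =1 f0}, {in dom C &, injective g} &
      {in dom C, forall x, x != r -> adj (g x) (g (pi x))}].
  elim: m C => [|m IH] C cardC CP.
    have C0 : C = set0 by apply/eqP; rewrite -cards_eq0 cardC.
    have dom0 : dom C = r |: big.
      by apply/setP=> x; rewrite C0 inE !in_set0 !orbF.
    exists f0; split=> //; rewrite dom0 // => x /setU1P[->|xb]; rewrite ?eqxx //.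
    by have [_ ->] := pi_center x (subsetP bigP x xb); rewrite adj_sym adj0.
  have [c cC] : exists c, c \in C by apply/card_gt0P; rewrite cardC.
  have cardC1 : #|C :\ c| = m by move: cardC; rewrite (cardsD1 c) cC => -[].
  have C1P : C :\ c \subset centers r pi :\: big.
    exact: subset_trans (subD1set C c) CP.
  have [g [g0 ginj gadj]] := IH _ cardC1 C1P.
  have /setDP[cP cb] := subsetP CP c cC.
  have [cr pc] := pi_center c cP.
  set U := g @: dom (C :\ c).
  have cardU : #|U| <= #|T| by apply: leq_trans (leq_imset_card _ _) (max_card _).
  (* At most [#|T|] vertices are used, so more than [#|T|] members of [J] are free, and the petal of
     one of them avoids all used vertices. *)
  have [||v] := @disjoint_family_avoid _ _ (J :\: U) P U.
  - by move=> i j /setDP[iJ _] /setDP[jJ _]; apply: disjP.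
  - have := subset_leq_card (subsetIr J U); rewrite cardsD; lia.
  move=> /setDP[vJ vU] PvU; have [Pvv DPv] := PJ v vJ.
  have rnC : r \notin C.
    by apply/negP=> /(subsetP CP) /setDP[/pi_center[]]; rewrite eqxx.
  have cdom : c \notin dom (C :\ c).
    rewrite inE in_setU1 (negbTE cr) (negbTE cb) /= pc !in_setD1 eqxx /=.
    by rewrite (negbTE rnC) andbF.
  pose g1 x := if x == c then v else g x.
  have g1c : g1 c = v by rewrite /g1 eqxx.
  have g1E x : x \in dom (C :\ c) -> g1 x = g x.
    by move=> xd; rewrite /g1; case: eqP => // E; rewrite E (negbTE cdom) in xd.
  have im1 : g1 @: (c |: dom (C :\ c)) = v |: U.
    by rewrite imsetU1 g1c; congr (_ |: _); apply: eq_in_imset.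
  have domC : dom C = (c |: dom (C :\ c)) :|: offspring pi c.
    apply/setP=> x; rewrite !inE.
    have [->|xc] := eqVneq x c; first by rewrite cC ?orbT.
    have [->|pxc] := eqVneq (pi x) c; first by rewrite cC ?orbT.
    by rewrite /= !orbF.
  have [||x|h [hg hinj hC]] :=
    @greedy_extension T G (c |: dom (C :\ c)) (dom C) g1 (fun=> P v).
  - by rewrite domC subsetUl.
  - move=> a b; rewrite !in_setU1 => /predU1P[->|aD] /predU1P[->|bD] //.
    + by rewrite g1c g1E // => E; move: vU; rewrite E imset_f.
    + by rewrite g1c g1E // => E; move: vU; rewrite -E imset_f.
    + by rewrite !g1E //; apply: ginj.
  - move=> xD; have -> : P v :\: g1 @: (c |: dom (C :\ c)) = P v.
      rewrite im1; apply/setDidPl; rewrite disjoint_sym disjoints_subset.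
      rewrite subUset -!disjoints_subset disjoints_subset sub1set inE.
      rewrite disjoint_sym PvU andbT; apply/negP=> /(subsetP Pvv).
      by rewrite inE adj_irrefl.
    apply: leq_trans DPv; apply: leq_trans (small c _); last by rewrite inE cb.
    by apply: subset_leq_card; rewrite domC setDUl setDv set0U subsetDl.
  have rD : r \in dom (C :\ c) by rewrite inE setU11.
  have hE x : x \in dom (C :\ c) -> h x = g x.
    by move=> xd; rewrite hg ?g1E // in_setU1 xd orbT.
  have hc : h c = v by rewrite hg ?setU11.
  exists h; split=> //.
    by move=> x xb; rewrite hE ?g0 // inE xb.
  move=> x; rewrite domC in_setU in_setU1 -orbA.
  case: (boolP (x \in dom (C :\ c))) => [xd _|xd] xr.
    rewrite !hE ?gadj //; rewrite inE; move: xd; rewrite inE.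
    case/or3P=> [/setU1P[xr'|xb]|xC|->]; last by rewrite !orbT.
    - by rewrite xr' eqxx in xr.
    - by have [_ ->] := pi_center x (subsetP bigP x xb); rewrite setU11.
    - have /setDP[xP _] := subsetP C1P x xC.
      by have [_ ->] := pi_center x xP; rewrite setU11.
  move: xr; have [->|xc] := eqVneq x c.
    move=> _ _; rewrite pc hc hE // g0 ?setU11 // adj_sym.
    by have := subsetP Jr v vJ; rewrite inE.
  move=> /=; rewrite inE => /eqP px xr; rewrite px hc adj_sym.
  have /hC : x \in dom C :\: (c |: dom (C :\ c)).
    have xo : x \in offspring pi c by rewrite inE px.
    by rewrite in_setD in_setU1 (negbTE xc) xd domC in_setU xo orbT.
  by move=> /setDP[/(subsetP Pvv)]; rewrite inE.
have [g [g0 ginj gadj]] := main _ _ erefl (subxx (centers r pi :\: big)).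
apply: (embeds_of_core piP (D := dom (centers r pi :\: big)) (f := g)) => //.
- apply/subsetP=> x /setU1P[->|xP]; first by rewrite inE setU11.
  by rewrite inE in_setU1 in_setD xP andbT; case: (x \in big); rewrite ?orbT.
- move=> x; rewrite in_setC inE !negb_or !in_setD => /and3P[_ _ pxP].
  suff px : pi x \in r |: big by rewrite g0 // deg0.
  move: pxP; rewrite in_setU1 (pi_centers piP).
  by case: (pi x == r) => //=; case: (pi x \in big).
Qed.

(** The tree is a spider: [c1], [r], [c2], [y] form a path, placed on [u], [v], [w], [x], and all
    other vertices are leaves at [c1], which find room around [u]. *)
Lemma embeds_path (c1 c2 y : T) (u v w x : G) :
  centers r pi = [set c1; c2] -> c1 != c2 -> children r pi = centers r pi ->
  offspring pi c2 = [set y] ->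
  adj u v -> adj v w -> adj w x -> uniq [:: u; v; w; x] ->
  #|T| <= #|nbr u| -> embeds r pi G.
Proof.
move=> P12 n12 PA off2 uv vw wx uq degu.
have pi_center c : c \in centers r pi -> c != r /\ pi c = r.
  by rewrite !inE => /andP[/andP[? /eqP]].
have [c1r pc1] : c1 != r /\ pi c1 = r by apply: pi_center; rewrite P12 set21.
have [c2r pc2] : c2 != r /\ pi c2 = r by apply: pi_center; rewrite P12 set22.
have py : pi y = c2.
  by have := set11 y; rewrite -off2 inE => /eqP.
have yr : y != r by apply: contraNneq c2r => E; rewrite -py E piP.1.
have yc c : pi c = r -> y != c.
  by move=> pc; apply: contraNneq c2r => E; rewrite -py E pc.
pose s := [:: r; c1; c2; y].
pose f z := nth u [:: v; u; w; x] (index z s).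
have fr : f r = v by rewrite /f /= eqxx.
have f1 : f c1 = u by rewrite /f /= eqxx eq_sym (negbTE c1r).
have f2 : f c2 = w by rewrite /f /= eq_sym (negbTE c2r) (negbTE n12) eqxx.
have fy : f y = x.
  rewrite /f /= eq_sym (negbTE yr) eq_sym (negbTE (yc c1 pc1)).
  by rewrite eq_sym (negbTE (yc c2 pc2)) eqxx.
have Ds z : (z \in [set z in s]) = (z \in s) by rewrite inE.
apply: (embeds_of_core piP (D := [set z in s]) (f := f)).
- rewrite P12; apply/subsetP=> z; rewrite !inE.
  by case/or3P=> ->; rewrite ?orbT.
- have uq' : uniq [:: v; u; w; x].
    move: uq; rewrite /= !inE !negb_or.
    move=> /and4P[/and3P[nuv nuw nux] /andP[nvw nvx] nwx _].
    by rewrite nvw nvx nwx nuw nux eq_sym nuv.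
  move=> a b; rewrite !Ds => aD bD /eqP; rewrite /f nth_uniq ?index_mem //.
  by move=> /eqP; apply: index_inj.
- move=> z; rewrite inE !in_cons in_nil orbF => /or4P[] /eqP-> zr.
  + by rewrite eqxx in zr.
  + by rewrite pc1 fr f1.
  + by rewrite pc2 fr f2 adj_sym.
  + by rewrite py f2 fy adj_sym.
- move=> z; rewrite in_setC inE !in_cons in_nil orbF !negb_or.
  move=> /and4P[zr z1 z2 zy].
  have zA : z \notin children r pi by rewrite PA P12 !inE negb_or z1.
  have : pi z \in centers r pi.
    by rewrite (pi_centers piP); move: zA; rewrite inE zr.
  rewrite P12 => /set2P[pz|]; first by rewrite pz f1.
  by move=> pz; move: zy; rewrite -in_set1 -off2 inE pz eqxx.
Qed.

End EmbeddingStars.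

(** * Vertices with a large second-order degree *)

Lemma subset_of_card (T : finType) (A : {set T}) k :
  k <= #|A| -> exists2 B : {set T}, B \subset A & #|B| = k.
Proof.
move=> kA; exists [set x in take k (enum A)].
  by apply/subsetP=> x; rewrite inE => /mem_take; rewrite mem_enum.
by rewrite cardsE (card_uniqP (take_uniq k (enum_uniq A))) size_takel // -cardE.
Qed.

Lemma card_nbr_lt (G : sgraph) (v : G) : #|nbr v| < #|G|.
Proof.
rewrite -cardsT; apply: proper_card; rewrite properEneq subsetT andbT.
by apply/eqP=> /setP/(_ v); rewrite !inE adj_irrefl.
Qed.

Lemma sum_card_nbr_inter (G : sgraph) (N : {set G}) :
  \sum_(v in N) #|nbr v| = \sum_(w : G) #|nbr w :&: N|.
Proof.
under eq_bigr do rewrite -sum1_card big_mkcond /=.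
rewrite exchange_big /=; apply: eq_bigr => w _.
rewrite -big_mkcondr sum1_card; apply: eq_card => v.
by rewrite unfold_in /= !inE andbC [adj v w]adj_sym.
Qed.

(** Without such a path, a neighbour [v] of [u] of degree at least three is the only neighbour of
    each [w != u] adjacent to it. Neighbours of degree at most two contribute at most [2] each, and
    the excess of the others counts every vertex of [G] at most once. *)
Lemma path3_of_degree_sum (G : sgraph) (u : G) :
  2 * #|nbr u| + #|G| < \sum_(v in nbr u) #|nbr v| ->
  exists v w x : G, [/\ adj u v, adj v w, adj w x & uniq [:: u; v; w; x]].
Proof.
pose good (p : G * G * G) :=
  [&& adj u p.1.1, adj p.1.1 p.1.2, adj p.1.2 p.2 & uniq [:: u; p.1.1; p.1.2; p.2]].
have [/existsP[[[v w] x] /and4P[? ? ? ?]]|] := boolP [exists p, good p].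
  by exists v, w, x.
move=> /existsPn noP lt; exfalso; move: lt; apply/negP; rewrite -leqNgt.
have neq_adj (a b : G) : adj a b -> a != b.
  by apply: contraTneq => ->; rewrite adj_irrefl.
(* The degree condition gives a third neighbour [w'] of [v]: if [u] sees [w], then [u], [w], [v],
   [w'] is a forbidden path; otherwise [u], [v], [w], [z] is one unless [z = v]. *)
have key v w z : adj u v -> 2 < #|nbr v| -> adj v w -> w != u -> adj w z -> z = v.
  move=> uv dv vw wu wz; apply/eqP; apply: contraT => zv.
  have [w' /setD1P[w'w /setD1P[w'u]]] : exists w', w' \in (nbr v :\ u) :\ w.
    apply/card_gt0P; move: dv; rewrite (cardsD1 u (nbr v)) (cardsD1 w (nbr v :\ u)).
    by lia.
  rewrite inE => vw'; have [uw|nuw] := boolP (adj u w).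
    have := noP (w, v, w'); rewrite /good /= uw adj_sym vw vw' /= !inE !negb_or.
    rewrite (neq_adj _ _ uw) (neq_adj _ _ uv) eq_sym w'u eq_sym (neq_adj _ _ vw).
    by rewrite eq_sym w'w (neq_adj _ _ vw').
  have uz : u != z by apply: contraNneq nuw => ->; rewrite adj_sym.
  have := noP (v, w, z); rewrite /good /= uv vw wz /= !inE !negb_or.
  rewrite (neq_adj _ _ uv) eq_sym wu uz (neq_adj _ _ vw) eq_sym zv.
  by rewrite (neq_adj _ _ wz).
pose N3 := [set v in nbr u | 2 < #|nbr v|].
apply: (@leq_trans (\sum_(v in nbr u) (2 + (if v \in N3 then #|nbr v :\ u| else 0)))).
  apply: leq_sum => v vN; rewrite inE vN /= (cardsD1 u (nbr v)).
  by case: ltnP; lia.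
rewrite big_split /= sum_nat_const mulnC leq_add2l -big_mkcondr /=.
under eq_bigr do rewrite -sum1_card big_mkcond /=.
rewrite exchange_big /= -sum1_card; apply: leq_sum => w _.
rewrite -big_mkcondr sum1_card; apply/card_le1_eqP => a b.
rewrite unfold_in /= !inE => /andP[/and3P[_ ua da] /andP[wu aw]].
rewrite unfold_in /= !inE => /andP[/and3P[_ ub db] /andP[_ bw]].
by apply: (key a w) => //; rewrite adj_sym.
Qed.

(* The row sum at [u] of [A^2 - (k-1) A] is at least [k (n-k)]. *)
Definition heavy_vertex (k : nat) (G : sgraph) (u : G) : Prop :=
  k * (#|G| - k) + (k - 1) * #|nbr u| <= \sum_(v in nbr u) #|nbr v|.

(** Here [W] counts the vertices with at least [k] neighbours in [nbr u]. Cancelling [(k - 1) * G]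
    leaves about [G <= W * t], so [W] grows linearly with [G]. *)
Lemma light_root_count k m S G N t d W :
  0 < k -> 0 < t -> G = k + m.+1 -> k < d -> k * k + t * N + t < G ->
  k * m.+1 + (k - 1) * d <= S -> S <= G * (k - 1) + W * t -> N <= W.
Proof.
case: k => [//|k] _ t0 -> kd; rewrite subSS subn0 => bigG lo hi.
rewrite -(leq_pmul2l t0).
have H : k * k.+1 <= k * d by rewrite leq_mul2l ltnW ?orbT.
move: H lo hi bigG.
rewrite !(mulSn, mulnDl, mulnS, mulnDr) [m * k]mulnC [W * t]mulnC; lia.
Qed.

(* If [u] has degree [k], all its neighbours are universal. Otherwise many
   vertices have at least [k] neighbours in the bounded set [nbr u], hence many
   of them share [k] of these, and [u] sees one further vertex. *)
Lemma embeds_light_root k (T : finType) (r : T) (pi : T -> T) (N : nat) :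
  0 < k -> parent_depth2 r pi -> #|T| = 2 * k + 3 -> #|centers r pi| <= k - 1 ->
  (forall (I V : finType) (L : {set I}) (F : I -> {set V}),
    {in L, forall i, #|F i| <= #|T|} -> N <= #|L| ->
    exists (J : {set I}) (K : {set V}), [/\ J \subset L, 2 * #|T| < #|J|,
      {in J, forall i, K \subset F i} &
      pairwise_disjoint_on J (fun i => F i :\: K)]) ->
  forall (G : sgraph) (u : G), k * k + #|T| * N + #|T| < #|G| ->
  heavy_vertex k u -> #|nbr u| < #|T| -> embeds r pi G.
Proof.
move=> k0 piP cT cP sunf G u bigG heavy ltd.
have kG : k < #|G| by lia.
have [m Em] : exists m, #|G| = k + m.+1 by exists (#|G| - k).-1; lia.
have degb (v : G) : #|nbr v| <= k + m by have := card_nbr_lt v; lia.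
have bigT : #|T| <= k + m by lia.
move: heavy; rewrite /heavy_vertex (_ : #|G| - k = m.+1); last by lia.
move=> heavy.
have le_sum : \sum_(v in nbr u) #|nbr v| <= #|nbr u| * (k + m).
  by rewrite -sum_nat_const; apply: leq_sum.
have kd : k <= #|nbr u|.
  rewrite leqNgt; apply/negP=> dk.
  have [e Ee] : exists e, k = #|nbr u| + e.+1 by exists (k - #|nbr u|).-1; lia.
  by nia.
have [dk|dk] := eqVneq #|nbr u| k.
  (* With [k] neighbours the heaviness bound equals [k * (k + m)], so each of them attains the
     maximal degree [k + m]. *)
  have univ v : v \in nbr u -> #|nbr v| = k + m.
    move=> vN; apply/eqP; rewrite eqn_leq degb /=.
    move: heavy; rewrite (bigD1 v) //=.
    have : \sum_(i in nbr u | i != v) #|nbr i| <= (k - 1) * (k + m).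
      have <- : #|nbr u :\ v| = k - 1 by move: dk; rewrite (cardsD1 v) vN; lia.
      rewrite -sum_nat_const (eq_bigl (fun i => i \in nbr u :\ v)); first exact: leq_sum.
      by move=> i; rewrite in_setD1 andbC.
    by rewrite dk; nia.
  have [s sN] : exists s, s \in nbr u by apply/card_gt0P; rewrite dk.
  have nbrs : nbr s = [set~ s].
    apply/eqP; rewrite eqEcard cardsC1 univ // Em addnS leqnn andbT.
    apply/subsetP=> v; rewrite !inE => sv.
    by apply: contraTneq sv => ->; rewrite adj_irrefl.
  apply: (embeds_centers_into piP (u := s) (S := nbr u :\ s)).
  - by move: dk; rewrite (cardsD1 s) sN; lia.
  - by rewrite nbrs; apply/subsetP=> v; rewrite !inE => /andP[].
  - rewrite univ //; apply: ltnW; apply: leq_trans bigT; exact: card_children.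
  - by move=> v /setD1P[_ vN]; rewrite univ.
pose W := [set w : G | k <= #|nbr w :&: nbr u|].
have NW : N <= #|W|.
  have : \sum_(v in nbr u) #|nbr v| <= #|G| * (k - 1) + #|W| * #|T|.
    rewrite sum_card_nbr_inter.
    apply: (@leq_trans (\sum_(w : G) ((k - 1) + (if w \in W then #|T| else 0)))).
      apply: leq_sum => w _; rewrite inE; case: (leqP k) => wk.
        apply: leq_trans (leq_addl _ _); apply: leq_trans (ltnW ltd).
        exact: subset_leq_card (subsetIr (nbr w) (nbr u)).
      by rewrite addn0 -ltnS subn1 prednK.
    by rewrite big_split /= -big_mkcondr /= !sum_nat_const.
  have ltkd : k < #|nbr u| by rewrite ltn_neqAle eq_sym dk.
  by apply: light_root_count Em ltkd bigG heavy; rewrite // cT; lia.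
have [w _|J [K [JW cardJ KF disj]]] := sunf G G W (fun w => nbr w :&: nbr u) _ NW.
  by have := subset_leq_card (subsetIr (nbr w) (nbr u)); lia.
(* All petals lie inside [nbr u], so one that avoids [nbr u] is empty. Its set then equals the
   kernel, which therefore has at least [k] elements. *)
have [|w wJ] := disjoint_family_avoid disj (U := nbr u); first by lia.
rewrite -setI_eq0 setIC setIDA setICA setIid => /eqP FwK.
have kK : k <= #|K|.
  have := subsetP JW w wJ; rewrite inE => /leq_trans; apply.
  by apply: subset_leq_card; rewrite -setD_eq0 FwK.
have [S SK cS] := subset_of_card kK.
have Su : S \subset nbr u.
  by apply: subset_trans SK _; apply: subset_trans (KF w wJ) _; apply: subsetIr.
have [s] : exists s, s \in nbr u :\: S.
  apply/card_gt0P; rewrite cardsD (setIidPr Su) cS; lia.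
move=> /setDP[su sS].
apply: (embeds_common_nbr piP (u := u) k0 cT cP cS _ _ su sS).
- apply: (@leq_trans #|J|); first by lia.
  apply: subset_leq_card; apply/subsetP=> v vJ; rewrite inE.
  apply/forall_inP=> z zS; have := subsetP (KF v vJ) z (subsetP SK z zS).
  by rewrite !inE adj_sym => /andP[].
- rewrite inE; apply/forall_inP=> z /(subsetP Su).
  by rewrite inE adj_sym.
Qed.

(** * Heavy vertices of large degree *)

(** At most [k - 2] summands are of the order of [G] and the others are at most [t]; the deficit
    must be covered by [d * t], so [d] is linear in the order of [G]. *)
Lemma heavy_root_degree k m h d t S :
  h + 2 <= k -> k * m.+1 + (k - 1) * d <= S -> S <= h * (k + m.+1) + d * t ->
  k + m.+1 <= k * k + d * t.
Proof.
move=> hk lo hi.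
have H : h * (k + m.+1) <= (k - 2) * (k + m.+1) by rewrite leq_mul2r; lia.
move: H lo hi; have -> : k = (k - 2).+2 by lia.
rewrite !subSS !subn0; move: (k - 2) => e.
rewrite !(mulSn, mulnDl, mulnS, mulnDr); lia.
Qed.

(** With [n = k + m.+1], the threshold [2k - 1 - h] leaves [(k - h) * n] on one side against
    [(k - 1 - h) * d] on the other; as [d < n], a surplus of about [d] falls on the [L] neighbours
    above the threshold. *)
Lemma heavy_root_count k m h d t S L :
  h + 2 <= k -> d < k + m.+1 -> k * m.+1 + (k - 1) * d <= S ->
  S <= h * (k + m.+1) + (d * (2 * k - 2 - h) + L * t) ->
  d <= k * k + L * t.
Proof.
move=> hk dn lo hi.
have [e Ek] : exists e, k = h + e.+2 by exists (k - h - 2); lia.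
have H : e.+2 * d <= e.+2 * (k + m.+1) by rewrite leq_mul2l ltnW ?orbT.
move: H lo hi; rewrite (_ : 2 * k - 2 - h = h + e + e.+2); last by lia.
rewrite (_ : k - 1 = h + e.+1) ?Ek; last by lia.
rewrite !(mulSn, mulnDl, mulnS, mulnDr) [d * h]mulnC [d * e]mulnC; lia.
Qed.

(* [H] is the set of neighbours of [u] of large degree; many other neighbours
   have degree at least [2k-1-h], and a sunflower among their neighbourhoods
   gives a core [K] (containing [u]) of vertices of large degree and disjoint
   petals of size at least [D]. With [u] as root, the stars with more than [D]
   leaves are centred in [H] and the others at members of the sunflower. If there
   are too many large stars, the tree is rooted at a member of the sunflower with
   all star centers in [K], except when it is the spider with two stars of
   sizes [2k-1] and [1], for which [u] is the center of the large star. *)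
Lemma embeds_heavy_root k (T : finType) (r : T) (pi : T -> T) (N : nat) :
  4 < k -> parent_depth2 r pi -> #|T| = 2 * k + 3 -> #|centers r pi| <= k - 1 ->
  (forall (I V : finType) (L : {set I}) (F : I -> {set V}),
    {in L, forall i, #|F i| <= #|T|} -> N <= #|L| ->
    exists (J : {set I}) (K : {set V}), [/\ J \subset L, 2 * #|T| < #|J|,
      {in J, forall i, K \subset F i} &
      pairwise_disjoint_on J (fun i => F i :\: K)]) ->
  forall (G : sgraph) (u : G),
  k * k + #|T| * (k * k + #|T| * N) + #|T| < #|G| ->
  heavy_vertex k u -> #|T| <= #|nbr u| -> embeds r pi G.
Proof.
move=> k4 piP cT cP sunf G u bigG heavy leTd.
have k0 : 0 < k by apply: leq_trans k4.
set p := #|centers r pi| in cP.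
set t := #|T| in cT bigG leTd.
have t0 : 0 < t by lia.
have [m Em] : exists m, #|G| = k + m.+1 by exists (#|G| - k).-1; lia.
pose H := [set v in nbr u | t <= #|nbr v|].
have Hu : H \subset nbr u by apply/subsetP=> v; rewrite inE => /andP[].
have Hdeg : {in H, forall v, t <= #|nbr v|} by move=> v; rewrite inE => /andP[].
have leAd : #|children r pi| <= #|nbr u|.
  by apply: leq_trans leTd; apply: ltnW; apply: card_children.
have [lepH|ltHp] := leqP p #|H|.
  by apply: (embeds_centers_into piP (u := u) (S := H)).
set h := #|H| in ltHp.
have hk : h + 2 <= k by lia.
pose L := nbr u :\: H.
have Llow v : v \in L -> #|nbr v| < t.
  by rewrite !inE ltnNge => /andP[+ uv]; rewrite uv.
have cardL : #|L| = #|nbr u| - h by rewrite cardsD (setIidPr Hu).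
pose L' := [set v in L | 2 * k - 1 - h <= #|nbr v|].
have split_sum : \sum_(v in nbr u) #|nbr v| <= h * (k + m.+1) + \sum_(v in L) #|nbr v|.
  rewrite (big_setID H) /= (setIidPr Hu) leq_add2r -Em -sum_nat_const.
  by apply: leq_sum => v _; apply: max_card.
move: heavy; rewrite /heavy_vertex (_ : #|G| - k = m.+1); last by lia.
move=> heavy.
have big_d : k * k + t * N <= #|nbr u|.
  have : k + m.+1 <= k * k + #|nbr u| * t.
    apply: heavy_root_degree hk heavy _; apply: leq_trans split_sum _.
    rewrite leq_add2l; apply: (@leq_trans (#|L| * t)); last first.
      by rewrite leq_mul2r cardL leq_subr orbT.
    by rewrite -sum_nat_const; apply: leq_sum => v /Llow /ltnW.
  by move=> H1; rewrite -(leq_pmul2l t0) [t * #|nbr u|]mulnC; lia.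
have NL : N <= #|L'|.
  rewrite -(leq_pmul2l t0) -(leq_add2l (k * k)); apply: leq_trans big_d _.
  rewrite [t * _]mulnC; apply: heavy_root_count hk _ heavy _.
    by rewrite -Em card_nbr_lt.
  apply: leq_trans split_sum _; rewrite leq_add2l.
  apply: (@leq_trans (\sum_(v in L) ((2 * k - 2 - h) + (if v \in L' then t else 0)))).
    apply: leq_sum => v vL; rewrite inE vL /=; case: (leqP (2 * k - 1 - h)) => vd.
      by apply: leq_trans (ltnW (Llow v vL)) (leq_addl _ _).
    by lia.
  rewrite big_split /= -big_mkcondr /= !sum_nat_const leq_add //.
    by rewrite leq_mul2r cardL leq_subr orbT.
  rewrite leq_mul2r; apply/orP; right.
  by apply: subset_leq_card; apply/subsetP=> v; rewrite unfold_in => /andP[].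
(* This supplies the path on four vertices for the spider in the last case. *)
have lt_path : 2 * #|nbr u| + #|G| < \sum_(v in nbr u) #|nbr v|.
  apply: leq_trans heavy.
  have H2d : 2 * #|nbr u| <= (k - 1) * #|nbr u| by rewrite leq_mul2r; lia.
  have H3m : 3 * m.+1 <= k * m.+1 by rewrite leq_mul2r; lia.
  have H2k : 2 * k <= k * k by rewrite leq_mul2r; lia.
  by lia.
have leTd' := leTd; clear heavy big_d split_sum bigG Em cardL.
have [v|J [K [JL' cardJ KF disj]]] := sunf G G L' (@nbr G) _ NL.
  by rewrite inE => /andP[/Llow/ltnW].
have tJ : t <= #|J| by apply: leq_trans (leq_pmull t _) (ltnW cardJ).
have JP v : v \in J -> [/\ v \in nbr u, v \in L & 2 * k - 1 - h <= #|nbr v|].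
  move=> /(subsetP JL'); rewrite inE => /andP[vL ->]; split=> //.
  by move: vL; rewrite inE => /andP[].
have [v0 v0J] : exists v, v \in J by apply/card_gt0P; lia.
have [v0u v0L degv0] := JP v0 v0J.
(* All members of [J] are adjacent to [u], and two disjoint petals cannot both contain it. *)
have uK : u \in K.
  apply: contraT => uK.
  have [v1 /setD1P[v10 v1J]] : exists v, v \in J :\ v0.
    by apply/card_gt0P; move: cardJ; rewrite (cardsD1 v0) v0J; lia.
  have [v1u _ _] := JP v1 v1J.
  have /disjoint_setI0/setP/(_ u) := disj v1 v0 v1J v0J v10.
  rewrite !inE uK /= in v0u v1u *.
  by rewrite ![adj _ u]adj_sym v0u v1u.
have KJ (S : {set G}) : S \subset K -> J \subset common_nbr S.
  move=> SK; apply/subsetP=> v vJ; rewrite inE; apply/forall_inP=> z zS.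
  by have := subsetP (KF v vJ) z (subsetP SK z zS); rewrite inE adj_sym.
(* Since [h <= k - 2], the vertex [v0] has at least [k + 1] neighbours, hence one outside any
   [k]-subset of the kernel. *)
have [kK|Kk] := leqP k #|K|.
  have [S SK cS] := subset_of_card kK.
  have Sv0 : S \subset nbr v0 by apply: subset_trans SK (KF v0 v0J).
  have [s] : exists s, s \in nbr v0 :\: S.
    by apply/card_gt0P; rewrite cardsD (setIidPr Sv0) cS; lia.
  move=> /setDP[sv0 sS].
  apply: (embeds_common_nbr piP (u := v0) _ cT cP cS _ _ sv0 sS).
  - exact: k0.
  - exact: leq_trans tJ (subset_leq_card (KJ S SK)).
  - exact: subsetP (KJ S SK) v0 v0J.
set kappa := #|K| in Kk.
(* A guaranteed petal size: [kappa] of at least [2k - 1 - h] neighbours lie in the kernel. As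
   [kappa < k], it is at least [2]. *)
pose D := 2 * k - 1 - h - kappa.
pose big := [set c in centers r pi | D < #|offspring pi c|].
have bigP : big \subset centers r pi by apply/subsetP=> c; rewrite inE => /andP[].
have [leBh|ltBh] := leqP #|big| h.
  have [f [injf fH]] := injection_of_card u leBh.
  have rb : r \notin big by rewrite !inE eqxx.
  pose f0 x := if x == r then u else f x.
  have f0r : f0 r = u by rewrite /f0 eqxx.
  have f0b c : c \in big -> f0 c = f c.
    by move=> cb; rewrite /f0; case: eqP => // E; rewrite E (negbTE rb) in cb.
  have adj0 c : c \in big -> adj u (f0 c).
    by move=> cb; rewrite f0b //; have := subsetP Hu _ (fH c cb); rewrite inE.
  have neq c : c \in big -> f0 c != u.
    by move=> cb; apply: contraTneq (adj0 c cb) => ->; rewrite adj_irrefl.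
  apply: (embeds_stars piP (f0 := f0) (big := big) (J := J)
            (P := fun v => nbr v :\: K) (D := D)) => //.
  - move=> a b; rewrite !in_setU1 => /predU1P[->|aP] /predU1P[->|bP] //.
    + by rewrite f0r => E; move: (neq b bP); rewrite -E eqxx.
    + by rewrite f0r => E; move: (neq a aP); rewrite E eqxx.
    + by rewrite !f0b //; apply: injf.
  - by move=> c cb; rewrite f0r adj0.
  - by move=> c /setU1P[->|cb]; rewrite ?f0r // f0b // Hdeg // fH.
  - by rewrite f0r; apply/subsetP=> v /JP[].
  - move=> v vJ; rewrite subsetDl cardsD (setIidPr (KF v vJ)).
    by have [_ _] := JP v vJ; split=> //; rewrite /D leq_sub2r.
  - move=> c /setDP[cC]; rewrite inE cC /= -leqNgt; exact.
(* More than [h] stars have at least [D + 1] leaves, and every star has at least one. *)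
have sum_off : p + h.+1 * D <= \sum_(c in centers r pi) #|offspring pi c|.
  apply: (@leq_trans (\sum_(c in centers r pi) (1 + (if c \in big then D else 0)))).
    rewrite big_split /= sum1_card leq_add2l -big_mkcondr /= sum_nat_cond_const.
    rewrite leq_mul2r; apply/orP; right; apply: leq_trans ltBh _.
    by apply: subset_leq_card; apply/subsetP=> c; rewrite !inE => /andP[-> ->].
  apply: leq_sum => c cC; rewrite inE cC /=; case: (ltnP D) => //= _.
  by rewrite card_gt0; move: cC; rewrite inE => /andP[].
have pA : p <= #|children r pi|.
  by apply: subset_leq_card; apply/subsetP=> c; rewrite inE => /andP[].
have := card_depth2 piP; rewrite -/t cT.
set A := #|children r pi| in pA leAd *; move=> cardT.
have DE : D + h + kappa = 2 * k - 1 by rewrite /D; lia.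
have hD : 2 * h <= h * D by rewrite mulnC leq_mul2l; apply/orP; right; lia.
have total : p + A + D + h * D <= 2 * k + 2.
  by rewrite mulSn in sum_off; lia.
have [lepk|ltkp] := leqP p kappa.
  apply: (embeds_centers_into piP (u := v0) (S := K)) => //.
  - exact: KF.
  - by apply: leq_trans degv0; rewrite -/A; lia.
  - move=> z zK; apply: leq_trans tJ _.
    apply: subset_leq_card; apply/subsetP=> v vJ.
    by have := subsetP (KF v vJ) z zK; rewrite !inE adj_sym.
have kap0 : 0 < kappa by apply/card_gt0P; exists u.
(* Now [A >= p >= kappa + 1 >= 2], and [total] with [DE] and [hD] gives [p - kappa + A + h <= 3], so
   all these inequalities are tight: the tree has two stars and no other child of the root. *)
have h0 : h = 0 by lia.
rewrite h0 mul0n addn0 in total DE.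
have [kap1 p2] : kappa = 1 /\ p = 2 by split; lia.
have [A2 D2] : A = 2 /\ D = 2 * k - 2 by split; lia.
have PA : children r pi = centers r pi.
  apply/esym/eqP; rewrite eqEcard -/p -/A p2 A2 andbT.
  by apply/subsetP=> c; rewrite inE => /andP[].
have [c1] : exists c, c \in big by apply/card_gt0P; lia.
rewrite inE D2 => /andP[c1P off1].
have /cards1P[c2 P1] : #|centers r pi :\ c1| == 1.
  by move: p2; rewrite /p (cardsD1 c1) c1P add1n => -[->].
have c2P : c2 \in centers r pi :\ c1 by rewrite P1 set11.
have P12 : centers r pi = [set c1; c2] by rewrite -(setD1K c1P) P1.
have n12 : c1 != c2 by move: c2P; rewrite in_setD1 eq_sym => /andP[].
(* The two stars have [2k] leaves together, at least [2k - 1] of them at [c1]. *)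
have off2 : #|offspring pi c2| = 1.
  have : 0 < #|offspring pi c2|.
    by rewrite card_gt0; move: c2P; rewrite !inE => /and3P[].
  move: cardT; rewrite (big_setD1 c1) //= P1 big_set1; lia.
have [y off2y] : exists y, offspring pi c2 = [set y].
  by apply/cards1P; rewrite off2.
have [v [w [x [uv vw wx uq]]]] := path3_of_degree_sum lt_path.
exact: (embeds_path piP P12 n12 PA off2y uv vw wx uq leTd').
Qed.

(** The same sunflower bound, for sets of at most [t] elements and [2t + 1] petals, serves both
    ranges of [#|nbr u|]; [n0] is dictated by the large-degree range. *)
Lemma embeds_heavy_vertex k : 4 < k -> exists n0, forall (G : sgraph) (u : G),
  n0 <= #|G| -> heavy_vertex k u ->
  forall (T : finType) (r : T) (pi : T -> T), parent_depth2 r pi ->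
  #|T| = 2 * k + 3 -> #|centers r pi| <= k - 1 -> embeds r pi G.
Proof.
move=> k4; set t := 2 * k + 3.
have [N sunf] := sunflower t (2 * t).+1.
exists (k * k + t * (k * k + t * N) + t).+1 => G u bigG heavy T r pi piP cT cP.
rewrite -cT in sunf.
have [ltd|led] := ltnP #|nbr u| #|T|.
  apply: (embeds_light_root _ piP cT cP sunf _ heavy ltd); first exact: leq_trans k4.
  rewrite cT; apply: leq_trans bigG; rewrite ltnS leq_add2r leq_add2l leq_mul2l.
  apply/orP; right; apply: leq_trans (leq_addl _ _); rewrite leq_pmull //.
  by rewrite /t addn3.
by apply: (embeds_heavy_root k4 piP cT cP sunf _ heavy led); rewrite cT.
Qed.

Import Order.TTheory GRing.Theory Num.Theory.

(** * Structure of trees of diameter at most four *)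

Section TreePaths.

Variable G : sgraph.
Implicit Types x y z : G.

Lemma gdist_le x (p : seq G) : path (@adj G) x p -> gdist x (last x p) <= size p.
Proof.
move=> xp; rewrite leqNgt; apply/negP=> lt.
have ltG : size p < #|G|.
  by apply: leq_trans lt _; rewrite /gdist -[leqRHS](size_iota 0) find_size.
have := before_find 0 lt; rewrite nth_iota // add0n => /negbT/negP[].
by rewrite /= /walk; apply/existsP; exists (in_tuple p); rewrite xp eqxx.
Qed.

(** By connectedness the search in [gdist] succeeds below [#|G|]. Removing repetitions from the walk
    found does not lengthen it, and [gdist_le] forbids shortening it. *)
Lemma geodesic x y : is_connected G ->
  exists p, [/\ path (@adj G) x p, last x p = y, uniq (x :: p) & size p = gdist x y].
Proof.
move=> [_ conn].
have [p xp yE] : exists2 p, path (@adj G) x p & y = last x p.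
  exact/connectP.
have hasw : has (fun m => walk m x y) (iota 0 #|G|).
  move: yE; case: (shortenP xp) => q xq uq _ yE; apply/hasP; exists (size q).
    rewrite mem_iota add0n /=; apply: leq_trans (max_card (mem (x :: q))).
    by rewrite (card_uniqP uq).
  by rewrite /= /walk; apply/existsP; exists (in_tuple q); rewrite xq -yE eqxx.
have lt : gdist x y < #|G| by rewrite -[ltnRHS](size_iota 0) -has_find.
have := nth_find 0 hasw; rewrite -/(gdist x y) nth_iota // add0n.
move=> /existsP[q /andP[xq /eqP qy]].
have := qy; case: (shortenP xq) => s xs us sq sy; exists s; split=> //.
apply/eqP; rewrite eqn_leq -{2}sy gdist_le // andbT.
rewrite -[leqRHS](size_tuple q); apply: uniq_leq_size => //.
by case/andP: us.
Qed.

Hypothesis acycG : acyclic G.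

(** The cycle [x], [p], [z], reversed [q] would have more than two vertices unless both paths are
    the edge from [x] to [z]. *)
Lemma acyclic_no_bigon x z (p q : seq G) :
  path (@adj G) x (rcons p z) -> path (@adj G) x (rcons q z) ->
  uniq (x :: rcons p z) -> uniq (x :: rcons q z) -> ~~ has (mem q) p ->
  p = [::] /\ q = [::].
Proof.
move=> xp xq up uq pq.
suff : ~~ (2 < size (x :: rcons p z ++ rev q)).
  rewrite /= size_cat size_rcons size_rev.
  by case: p {xp up pq} => [|? ?] //; case: q {xq uq}.
apply/negP=> /acycG; apply; rewrite /ucycle; apply/andP; split.
  rewrite /= rcons_cat cat_path xp last_rcons /= -rev_cons.
  have := rev_path (@adj G) x (rcons q z); rewrite last_rcons belast_rcons => ->.
  by rewrite (eq_path (e' := @adj G)) // => a b; rewrite adj_sym.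
move: up uq; rewrite /= !rcons_uniq !mem_rcons !in_cons !negb_or.
move=> /andP[/andP[xz xNp] /andP[zNp up]] /andP[/andP[_ xNq] /andP[zNq uq]].
rewrite mem_cat mem_rcons in_cons !negb_or xz xNp mem_rev xNq /=.
rewrite cat_uniq rcons_uniq zNp up rev_uniq uq /= andbT.
apply/hasPn=> a; rewrite mem_rev => aq; rewrite /= mem_rcons in_cons negb_or.
apply/andP; split; first by apply: contraNneq zNq => <-.
by apply: contra pq => ap; apply/hasP; exists a.
Qed.

(** Common first steps are stripped. If the first steps differ, the first vertex of [p] on [q]
    closes a bigon, which forces both first steps to be that vertex. *)
Lemma acyclic_path_inj x (p q : seq G) :
  path (@adj G) x p -> path (@adj G) x q -> uniq (x :: p) -> uniq (x :: q) ->
  last x p = last x q -> p = q.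
Proof.
elim: p x q => [|a p IH] x q.
  case: q => [//|b q] _ _ _ /= /andP[xq _] E.
  by move: xq; rewrite E mem_last.
case: q => [|b q].
  by move=> _ _ /= /andP[xq _] _ E; move: xq; rewrite -E mem_last.
move=> xp xq up uq E.
have [ab|ab] := eqVneq a b.
  subst b; congr (_ :: _); move: xp xq up uq E => /= /andP[_ ap] /andP[_ aq].
  by move=> /andP[_ up] /andP[_ uq]; apply: IH.
exfalso.
have meet : has (mem (b :: q)) (a :: p).
  apply/hasP; exists (last a p); first by rewrite mem_last.
  by move: E => /= ->; rewrite /= mem_last.
have [p1 [z [p2 [Ep zq p1q]]]] : exists p1 z p2,
    [/\ a :: p = rcons p1 z ++ p2, z \in b :: q & ~~ has (mem (b :: q)) p1].
  by case: (split_find meet) => z p1 p2 zq p1q; exists p1, z, p2.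
have [q1 [q2 Eq]] : exists q1 q2, b :: q = rcons q1 z ++ q2.
  by case/path.splitP: zq => q1 q2; exists q1, q2.
have [] := @acyclic_no_bigon x z p1 q1.
- by move: xp; rewrite Ep cat_path => /andP[].
- by move: xq; rewrite Eq cat_path => /andP[].
- by move: up; rewrite Ep -cat_cons cat_uniq => /andP[].
- by move: uq; rewrite Eq -cat_cons cat_uniq => /andP[].
- apply: contra p1q => /hasP[c cp cq]; apply/hasP; exists c => //.
  by rewrite -[mem _ c]/(c \in b :: q) Eq mem_cat mem_rcons in_cons (cq : c \in q1) orbT.
move=> p10 q10; move: Ep Eq ab; rewrite p10 q10 /= => -[-> _] [-> _].
by rewrite eqxx.
Qed.

(* If [v] has eccentricity [e >= 3], attained at [x], let [w] be the first vertex
   towards [x] and [y] at distance at least [e] from [w]: the paths from [v] to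
   [x] and [y] only share [v], so [x] and [y] are at distance at least [2e-1]. *)
Lemma center_ecc (v : G) : is_connected G -> is_center v -> diameter G <= 4 -> ecc v <= 2.
Proof.
move=> connG /forallP cv diam; rewrite leqNgt; apply/negP=> ev.
have G0 : 0 < #|G| by case: connG.
have le_ecc (a b : G) : gdist a b <= ecc a by apply: (leq_bigmax (F := gdist a)).
have ecc_at (a : G) : exists b, ecc a = gdist a b.
  by have [b Eb] := bigop.eq_bigmax (gdist a) G0; exists b.
have [x Ex] := ecc_at v.
have [P [vP Px uP sP]] := geodesic v x connG.
case: P => [|w P] in vP Px uP sP; first by move: ev; rewrite Ex -sP.
have [y Ey] := ecc_at w.
have ley : ecc v <= gdist w y by rewrite -Ey; apply: cv.
have [Q [vQ Qy uQ sQ]] := geodesic v y connG.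
have Qle : size Q <= ecc v by rewrite sQ.
move: (vP) => /= /andP[vw wP].
(* Passing through [w], the geodesic [Q] would bring [y] closer to [w] than [ecc v]. *)
have wQ : w \notin Q.
  apply/negP=> wQ; move: vQ Qy Qle; case/splitPr: wQ => Q1 Q2.
  rewrite cat_path last_cat /= => /and3P[_ _ wQ2] wy; rewrite size_cat /=.
  have := gdist_le wQ2; rewrite wy => le1 le2; move: ley.
  by rewrite leqNgt (leq_ltn_trans le1) // (leq_trans _ le2) // addnS ltnS leq_addl.
have Qge : ecc v <= (size Q).+1.
  have /gdist_le : path (@adj G) w (v :: Q) by rewrite /= adj_sym vw.
  by rewrite /= Qy; apply: leq_trans.
(* A common vertex [z] would have two paths from [w]: one along [P], avoiding [v], and one through
   [v]. *)
have PQ : ~~ has (mem P) Q.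
  apply/negP=> /hasP[z zQ zP].
  have [P1 [P2 EP]] : exists P1 P2, P = rcons P1 z ++ P2.
    by case/path.splitP: zP => P1 P2; exists P1, P2.
  have [Q1 [Q2 EQ]] : exists Q1 Q2, Q = rcons Q1 z ++ Q2.
    by case/path.splitP: zQ => Q1 Q2; exists Q1, Q2.
  have : rcons P1 z = v :: rcons Q1 z.
    apply: (@acyclic_path_inj w).
    - by move: wP; rewrite EP cat_path => /andP[].
    - by move: vQ; rewrite EQ cat_path /= adj_sym vw => /andP[->].
    - by move: uP; rewrite cons_uniq EP -cat_cons cat_uniq => /and3P[_ ->].
    - move: uQ wQ; rewrite EQ -cat_cons cat_uniq mem_cat negb_or => /andP[uQ1 _].
      move=> /andP[wQ1 _].
      rewrite [w :: _]/= cons_uniq uQ1 andbT in_cons negb_or wQ1 andbT.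
      by apply: contraTneq vw => ->; rewrite adj_irrefl.
    - by rewrite /= !last_rcons.
  move=> E; have : v \in P by rewrite EP mem_cat E in_cons eqxx.
  by move: uP; rewrite /= in_cons negb_or => /andP[/andP[_ /negP]].
pose S := rev (belast w P) ++ v :: Q.
have revP : rev (w :: P) = x :: rev (belast w P) by rewrite lastI rev_rcons -Px.
have xS : x :: S = rev (w :: P) ++ v :: Q by rewrite revP.
have pathS : path (@adj G) x S.
  have lastrev : last x (rev (belast w P)) = w.
    by rewrite -[LHS]/(last w (x :: rev (belast w P))) -revP rev_cons last_rcons.
  rewrite cat_path lastrev /= adj_sym vw vQ /= andbT.
  have := rev_path (@adj G) w P; rewrite -[last w P]/(last v (w :: P)) Px => ->.
  by rewrite (eq_path (e' := @adj G)) // => a b; rewrite adj_sym.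
have uS : uniq (x :: S).
  rewrite xS cat_uniq rev_uniq; move: uP uQ; rewrite cons_uniq => /andP[vNP ->] ->.
  rewrite andbT /=; rewrite negb_or mem_rev vNP /=.
  apply/hasPn=> a aQ; rewrite /= mem_rev in_cons negb_or.
  apply/andP; split; first by apply: contraNneq wQ => <-.
  by apply: contra PQ => aP; apply/hasP; exists a.
have Sy : last x S = y by rewrite last_cat.
have [R [xR Ry uR sR]] := geodesic x y connG.
have RS : R = S by apply: (acyclic_path_inj xR pathS uR uS); rewrite Ry Sy.
have : gdist x y <= 4.
  apply: leq_trans (le_ecc x y) _; apply: leq_trans diam.
  exact: (leq_bigmax (F := @ecc G)).
rewrite -sR RS size_cat size_rev size_belast /=; apply/negP; rewrite -ltnNge.
rewrite -Ex /= in sP; rewrite -addSnnS sP.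
by apply: (leq_add ev (_ : 2 <= size Q)); rewrite -ltnS; apply: leq_trans Qge.
Qed.

End TreePaths.

(** Every vertex is within distance two of [r]. An edge not joining a vertex to its parent would
    close a cycle of length three, four or five. *)
Lemma parent_function (T : sgraph) (r : T) : is_tree T -> ecc r <= 2 ->
  exists pi : T -> T, [/\ parent_depth2 r pi,
    forall x, x != r -> adj x (pi x) &
    forall x y, adj x y -> (x != r /\ y = pi x) \/ (y != r /\ x = pi y)].
Proof.
move=> [connT acyc] er.
(* For [x] neither equal nor adjacent to [r], the [pick] succeeds by the eccentricity bound. *)
pose pi x := if adj r x || (x == r) then r else
  odflt r [pick z | adj r z && adj z x].
have pi_near x : adj r x -> pi x = r by rewrite /pi => ->.
have pi_r : pi r = r by rewrite /pi eqxx orbT.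
have pi_far x : x != r -> ~~ adj r x -> adj r (pi x) /\ adj (pi x) x.
  move=> xr rx; rewrite /pi (negbTE xr) (negbTE rx) /=.
  case: pickP => [z /andP[]//|no]; exfalso.
  have [p [rp px _ sp]] := geodesic r x connT.
  have : size p <= 2.
    by rewrite sp; apply: leq_trans er; apply: (leq_bigmax (F := gdist r)).
  move: rp px {sp}; case: p => [|a [|b [|? ?]]] //=.
  - by move=> _ E; rewrite E eqxx in xr.
  - by rewrite andbT => ra E; rewrite -E ra in rx.
  - by move=> /and3P[ra ab _] E; have := no a; rewrite ra -E ab.
have neq (a b : T) : adj a b -> a != b.
  by apply: contraTneq => ->; rewrite adj_irrefl.
have adj_pi x : x != r -> adj x (pi x).
  move=> xr; have [rx|rx] := boolP (adj r x).
    by rewrite pi_near // adj_sym.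
  by have [_] := pi_far x xr rx; rewrite adj_sym.
have triangle (a b c : T) : adj a b -> adj b c -> adj c a -> False.
  move=> ab bc ca; apply: (acyc [:: a; b; c]) => //.
  rewrite /ucycle /= ab bc ca /= !inE negb_or (neq _ _ ab) (neq _ _ bc).
  by rewrite eq_sym (neq _ _ ca).
have square (a b c d : T) : adj a b -> adj b c -> adj c d -> adj d a ->
    a != c -> b != d -> False.
  move=> ab bc cd da ac bd; apply: (acyc [:: a; b; c; d]) => //.
  rewrite /ucycle /= ab bc cd da /= !inE !negb_or ac bd (neq _ _ ab) (neq _ _ bc).
  by rewrite (neq _ _ cd) eq_sym (neq _ _ da).
exists pi; split=> //.
  split=> // x; have [->|xr] := eqVneq x r; first by rewrite !pi_r.
  have [rx|rx] := boolP (adj r x); first by rewrite (pi_near x rx).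
  by have [rp _] := pi_far x xr rx; rewrite pi_near.
move=> x y xy.
have [xE|xr] := eqVneq x r.
  right; split; last by rewrite xE pi_near // -xE.
  by rewrite -xE eq_sym neq.
have [yE|yr] := eqVneq y r.
  by left; split=> //; rewrite yE pi_near // adj_sym -yE.
have [rx|rx] := boolP (adj r x); have [ry|ry] := boolP (adj r y).
- by case: (triangle r x y rx xy); rewrite adj_sym.
- right; split=> //; have [rp py] := pi_far y yr ry.
  apply/eqP; apply: contraT => ne; exfalso.
  apply: (square r x y (pi y)); rewrite // 1?adj_sym //.
  by rewrite eq_sym.
- left; split=> //; have [rp px] := pi_far x xr rx.
  apply/eqP; apply: contraT => ne; exfalso.
  by apply: (square r y x (pi x)); rewrite // 1?adj_sym // eq_sym.
exfalso; have [rpx px] := pi_far x xr rx; have [rpy py] := pi_far y yr ry.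
have [E|ne] := eqVneq (pi x) (pi y).
  by apply: (triangle (pi x) x y px xy); rewrite E adj_sym.
apply: (acyc [:: r; pi x; x; y; pi y]) => //.
have npx a : adj r a -> a != x by apply: contraTneq => ->.
have npy a : adj r a -> a != y by apply: contraTneq => ->.
rewrite /ucycle /= rpx px xy adj_sym py adj_sym rpy /= !inE !negb_or.
rewrite ne (neq _ _ rpx) (neq _ _ rpy) (neq _ _ xy) eq_sym xr eq_sym yr.
by rewrite !npx // !npy // eq_sym npx // eq_sym npy.
Qed.

(** Each star center with its offspring is a component of the tree minus its root and a star with at
    least two vertices; distinct centers give distinct components. *)
Lemma centers_nontrivial_stars (T : sgraph) (r : T) (pi : T -> T) :
  parent_depth2 r pi -> (forall x, x != r -> adj x (pi x)) ->
  (forall x y, adj x y -> (x != r /\ y = pi x) \/ (y != r /\ x = pi y)) ->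
  #|centers r pi| <= nontrivial_stars r.
Proof.
move=> piP adj_pi adjE.
have pi_center c : c \in centers r pi -> [/\ c != r, pi c = r & offspring pi c != set0].
  by rewrite !inE => /andP[/andP[? /eqP ?] ?].
pose branch c : {set delete_vertex r} := [set z | (val z == c) || (pi (val z) == c)].
have inj : {in centers r pi &, injective branch}.
  move=> a b /pi_center[ar pa _] /pi_center[br pb _] /setP/(_ (Sub a ar)).
  rewrite !inE /= eqxx pa /= => /esym/orP[/eqP->//|/eqP E].
  by rewrite E eqxx in br.
rewrite -(card_in_imset inj); apply: subset_leq_card.
apply/subsetP=> _ /imsetP[c /pi_center[cr pc coff] ->].
have [y] := set0Pn _ coff; rewrite inE => /eqP py.
have yr : y != r by apply: contraNneq cr => E; rewrite -py E piP.1.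
pose c' : delete_vertex r := Sub c cr; pose y' : delete_vertex r := Sub y yr.
have nc (z : T) : pi z = c -> z != c.
  by move=> pz; apply: contraNneq (cr) => E; rewrite -pz E pc.
rewrite inE; apply/and3P; split.
- apply/imsetP; exists c'; first by rewrite inE.
  apply/setP=> z; rewrite !inE /=; apply/idP/idP.
    case/orP=> /eqP E.
      by have -> : z = c' by apply: val_inj.
    by apply: connect1; rewrite /= adj_sym -E adj_pi //; apply: (valP z).
  pose top := [pred z : delete_vertex r | (val z == c) || (pi (val z) == c)].
  have cl : closed (@adj (delete_vertex r)) top.
    apply: (intro_closed (sym_connect_sym (@adj_sym _))).
    move=> a b /= /adjE[[ar bE]|[br aE]].
      rewrite !unfold_in /= => /orP[/eqP E|/eqP E].
        by have /= := valP b; rewrite bE E pc eqxx.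
      by rewrite bE E eqxx.
    rewrite !unfold_in /= aE => /orP[->|/eqP E]; first by rewrite orbT.
    by move: (cr); rewrite -E piP.2 eqxx.
  by move=> /(closed_connect cl); rewrite !inE /= eqxx => <-.
- apply/existsP; exists c'; rewrite inE /= eqxx /=.
  apply/forall_inP=> a; rewrite inE => aB; apply/forall_inP=> b; rewrite inE => bB.
  have valE (z : delete_vertex r) : (z == c') = (val z == c) by [].
  rewrite !valE /=; move: aB bB.
  have [ea|na] := eqVneq (val a) c; have [eb|nb] := eqVneq (val b) c; move=> /= aB bB.
  + by rewrite ea eb adj_irrefl.
  + by rewrite ea -(eqP bB) adj_sym adj_pi //; apply: (valP b).
  + by rewrite eb -(eqP aB) adj_pi //; apply: (valP a).
  + rewrite eqbF_neg; apply/negP=> /adjE[[_ E]|[_ E]].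
      by move/eqP: nb; apply; rewrite [LHS]E; apply/eqP.
    by move/eqP: na; apply; rewrite [LHS]E; apply/eqP.
- rewrite (cardsD1 c') (cardsD1 y') !inE /= eqxx py eqxx orbT /= -val_eqE /= nc //.
Qed.

Lemma Tstar_parent k (T : sgraph) : in_Tstar k T ->
  exists (r : T) (pi : T -> T), [/\ parent_depth2 r pi,
    forall x y, adj x y -> (x != r /\ y = pi x) \/ (y != r /\ x = pi y),
    #|T| = 2 * k + 3 & #|centers r pi| <= k - 1].
Proof.
move=> [treeT cT diam [r [cr _] stars]].
have er : ecc r <= 2 by apply: center_ecc cr diam; case: treeT.
have [pi [piP adj_pi adjE]] := parent_function treeT er.
exists r, pi; split=> //.
exact: leq_trans (centers_nontrivial_stars piP adj_pi adjE) stars.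
Qed.

(** * Spectral radius *)

Section SpectralRadius.

Local Open Scope ring_scope.
Local Open Scope complex_scope.

Variable R : realType.

Lemma eigenvaluesE n (A : 'M[R[i]]_n) : eigenvalues A =i eigenvalue A.
Proof.
move=> z; rewrite -[RHS]/(eigenvalue A z) eigenvalue_root_char /eigenvalues.
case: closed_field_poly_normal => s /= ->.
by rewrite (monicP (char_poly_monic A)) scale1r root_prod_XsubC.
Qed.

Lemma le_spectral_radius n (A : 'M[R[i]]_n) (z : R[i]) :
  eigenvalue A z -> complex.Re `|z| <= spectral_radius A.
Proof.
move=> Az; rewrite /spectral_radius.
by apply: (le_bigmax_seq _ z) => //; rewrite eigenvaluesE.
Qed.

(** Positivity rules out the default value [0] of the maximum. *)
Lemma spectral_radius_attained n (A : 'M[R[i]]_n) :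
  0 < spectral_radius A ->
  exists2 z, eigenvalue A z & spectral_radius A = complex.Re `|z|.
Proof.
move=> sr0; pose P (x : R) := 0 < x -> exists2 z, eigenvalue A z & x = complex.Re `|z|.
suff : P (spectral_radius A) by apply.
rewrite /spectral_radius big_seq; elim/big_ind: _ => [|x y Px Py|z].
- by rewrite /P ltxx.
- by rewrite /P; case: (leP x y) => _ => [/Py|/Px].
- by rewrite eigenvaluesE => Az _; exists z.
Qed.

Lemma Re_norm_real (z : R[i]) : (complex.Re `|z|)%:C = `|z|.
Proof. by rewrite RRe_real ?normr_real. Qed.

Lemma sum_adjmx (G : sgraph) (v : 'rV[R[i]]_#|G|) (y : G) :
  (v *m adjmx R G) 0 (enum_rank y) =
  \sum_(x : G | adj y x) v 0 (enum_rank x).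
Proof.
rewrite mxE (reindex enum_rank) /=; last by apply: onW_bij; apply: enum_rank_bij.
rewrite [RHS]big_mkcond /=; apply: eq_bigr => x _.
by rewrite mxE !enum_rankK adj_sym; case: adj; rewrite ?mulr1 ?mulr0.
Qed.

(** The entries are the moduli of an eigenvector for an eigenvalue of largest modulus; the triangle
    inequality gives the last condition. *)
Lemma mu_subeigenvector (G : sgraph) : 0 < mu R G ->
  exists x : G -> R, [/\ forall v, 0 <= x v, 0 < \sum_v x v &
    forall v, mu R G * x v <= \sum_(w | adj v w) x w].
Proof.
move=> /spectral_radius_attained[z /eigenvalueP[v vA vn0]].
rewrite -/(mu R G) => muE.
exists (fun y => complex.Re `|v 0 (enum_rank y)|).
have ge0 y : 0 <= complex.Re `|v 0 (enum_rank y)|.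
  by rewrite -lecR Re_norm_real normr_ge0.
split=> //.
  rewrite lt0r sumr_ge0 // andbT; apply: contra vn0 => /eqP s0.
  apply/eqP/rowP=> i; rewrite mxE -(enum_valK i).
  have /eqP := s0; rewrite psumr_eq0 // => /allP/(_ (enum_val i)).
  rewrite mem_index_enum => /(_ isT) /eqP n0.
  by apply/eqP; rewrite -normr_eq0 -Re_norm_real n0.
move=> y; rewrite muE -lecR rmorphM /= !Re_norm_real -normrM rmorph_sum /=.
have := sum_adjmx v y; rewrite vA mxE => ->.
apply: le_trans (ler_norm_sum _ _ _) _.
by apply: ler_sum => x _; rewrite Re_norm_real.
Qed.

End SpectralRadius.

(** * From the spectral radius to a heavy vertex *)

Section HeavyVertex.

Local Open Scope ring_scope.
Local Open Scope complex_scope.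

Lemma sum_nbr (R : pzRingType) (G : sgraph) (f : G -> R) :
  \sum_v \sum_(w | adj v w) f w = \sum_w #|nbr w|%:R * f w.
Proof.
under eq_bigr do rewrite big_mkcond /=.
rewrite exchange_big /=; apply: eq_bigr => w _.
rewrite -big_mkcond /= sumr_const mulr_natl; congr (_ *+ _).
by apply: eq_card => v; rewrite !inE adj_sym.
Qed.

(* Sum the entries of [(A^2 - (k-1) A) x] in two ways; the column sums of
   [A^2 - (k-1) A] are the quantities in [heavy_vertex]. *)
Lemma heavy_vertex_of_subeigenvector (R : realDomainType) (G : sgraph) (k : nat)
    (m : R) (x : G -> R) :
  0 <= m -> (k - 1)%N%:R <= m ->
  (k * (#|G| - k))%N%:R <= m * (m - (k - 1)%N%:R) ->
  (forall v, 0 <= x v) -> 0 < \sum_v x v ->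
  (forall v, m * x v <= \sum_(w | adj v w) x w) ->
  exists u : G, heavy_vertex k u.
Proof.
move=> m0 km hm x0 sx subx.
have [/existsP[u hu]|/existsPn no] := boolP [exists u : G,
  (k * (#|G| - k) + (k - 1) * #|nbr u| <= \sum_(v in nbr u) #|nbr v|)%N].
  by exists u.
exfalso.
set c := (k * (#|G| - k))%N in hm no; set a : R := (k - 1)%N%:R in km hm.
pose s v := \sum_(w | adj v w) x w.
have lower : m * \sum_v s v <= \sum_v \sum_(w | adj v w) s w.
  rewrite mulr_sumr; apply: ler_sum => v _; rewrite mulr_sumr.
  by apply: ler_sum => w _; apply: subx.
(* The [- 1] comes from integrality: each column sum misses [c] by at least one. *)
have upper : \sum_v \sum_(w | adj v w) s w <=
    (c%:R - 1) * \sum_v x v + a * \sum_v s v.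
  have -> : \sum_v \sum_(w | adj v w) s w =
      \sum_l (\sum_(w in nbr l) #|nbr w|)%N%:R * x l.
    rewrite sum_nbr; under eq_bigr do rewrite /s mulr_sumr big_mkcond /=.
    rewrite exchange_big /=; apply: eq_bigr => l _.
    rewrite -big_mkcond natr_sum mulr_suml; apply: eq_bigl => w.
    by rewrite inE adj_sym.
  rewrite sum_nbr !mulr_sumr -big_split /=; apply: ler_sum => l _.
  rewrite mulrA -mulrDl ler_wpM2r //.
  have := no l; rewrite -ltnNge -(ler_nat R) -addn1 !natrD natrM -/a; lra.
have mX : m * \sum_v x v <= \sum_v s v.
  by rewrite mulr_sumr; apply: ler_sum => v _; apply: subx.
(* With [X] the sum of [x], the chain [c * X <= m * (m - a) * X <= (m - a) * \sum_v s v <= (c - 1) *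
   X] contradicts [X > 0]. *)
have : (m - a) * (m * \sum_v x v) <= (m - a) * \sum_v s v.
  by rewrite ler_wpM2l // subr_ge0.
have : c%:R * \sum_v x v <= m * (m - a) * \sum_v x v.
  by rewrite ler_wpM2r // ltW.
lra.
Qed.

Variable R : realType.

Lemma mu_Snk_ge (n k : nat) (theta : R) :
  (0 < k)%N -> 0 < theta ->
  theta * theta = (k - 1)%N%:R * theta + (k * (n - k))%N%:R ->
  theta <= mu R (Snk n k).
Proof.
move=> k0 theta0 theta_eq.
have -> : theta = complex.Re `|theta%:C|.
  apply: (@complexI R); rewrite Re_norm_real ger0_norm //.
  by rewrite -[0]/(0%:C) lecR ltW.
apply: le_spectral_radius; apply/eigenvalueP.
(* An eigenvector constant on both parts: the equation on the clique is [theta_eq], and the one on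
   the independent set reads [k * theta = theta * k]. *)
pose y (v : Snk n k) : R := if v is inl _ then theta else k%:R.
exists (\row_i (y (enum_val i))%:C).
  apply/rowP=> i; rewrite -(enum_valK i) sum_adjmx !mxE enum_rankK.
  under eq_bigr do rewrite mxE enum_rankK.
  rewrite -rmorph_sum -rmorphM /=; congr _%:C.
  rewrite big_mkcond big_sumType /=.
  case: (enum_val i) => j /=.
    under eq_bigr do rewrite eq_sym.
    rewrite -big_mkcond /= sumr_const (_ : #|_| = (k - 1)%N); last first.
      by rewrite (eq_card (B := predC1 j)) // cardC1 card_ord subn1.
    rewrite sumr_const card_ord theta_eq natrM.
    by rewrite -[theta *+ _]mulr_natl -[_ *+ (n - k)]mulr_natr.
  under [X in _ + X]eq_bigr do rewrite /gjoin_adj /=.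
  rewrite sumr_const card_ord [X in _ + X]big1 ?addr0; last first.
    by move=> l _; case: eqP => //=.
  by rewrite mulr_natr.
apply/eqP=> /rowP/(_ (enum_rank (inl (Ordinal k0) : Snk n k))).
rewrite !mxE enum_rankK /= => /(@complexI R) theta_0.
by rewrite theta_0 ltxx in theta0.
Qed.

(** For the positive root [theta] of [t^2 - (k-1) t = k (n-k)], the map [t * (t - (k-1))] is
    increasing beyond [k - 1], so [mu R G >= theta] carries the equation over to an inequality. *)
Lemma heavy_vertex_of_mu (k : nat) (G : sgraph) :
  (0 < k < #|G|)%N -> mu R (Snk #|G| k) <= mu R G ->
  exists u : G, heavy_vertex k u.
Proof.
move=> /andP[k0 kG] le_mu; set n := #|G| in kG le_mu.
pose a : R := (k - 1)%N%:R; pose c : R := (k * (n - k))%N%:R.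
have a0 : 0 <= a by rewrite ler0n.
have c0 : 0 < c by rewrite ltr0n muln_gt0 k0 subn_gt0.
pose q := Num.sqrt (a * a + 4%:R * c).
have q0 : 0 <= q by apply: sqrtr_ge0.
have qq : q * q = a * a + 4%:R * c.
  by rewrite -expr2 sqr_sqrtr //; nra.
pose theta := (a + q) / 2%:R.
have aq : a < q by nra.
have theta_gt : a < theta by rewrite /theta; lra.
have theta_eq : theta * theta = a * theta + c by rewrite /theta; nra.
have theta0 : 0 < theta by apply: le_lt_trans theta_gt.
have le_theta : theta <= mu R G by apply: le_trans le_mu; apply: mu_Snk_ge.
have mu0 : 0 < mu R G by apply: lt_le_trans le_theta.
have [x [x0 sx subx]] := mu_subeigenvector mu0.
apply: (heavy_vertex_of_subeigenvector _ _ _ x0 sx subx).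
- exact: ltW.
- by apply: le_trans le_theta; apply: ltW.
- rewrite -/a -/c; apply: (@le_trans _ _ (theta * (theta - a))); last first.
    by apply: ler_pM; rewrite ?lerB // ?subr_ge0 ltW.
  by lra.
Qed.

End HeavyVertex.

Local Open Scope ring_scope.

Theorem theorem3p1 (R : realType) (k : nat) (hk : (8 <= k)%N) :
  exists n0 : nat, forall n : nat, (n0 <= n)%N ->
    forall G : sgraph, #|G| = n -> mu R (Snk n k) <= mu R G ->
      forall T : sgraph, in_Tstar k T -> has_subgraph G T.
Proof.
have k4 : (4 < k)%N by apply: leq_trans hk.
have [n0 embedsG] := embeds_heavy_vertex k4.
(* The bound [k.+1] ensures [k < #|G|], so that [k * (n - k)] is positive. *)
exists (maxn n0 k.+1) => n; rewrite geq_max => /andP[n0n kn] G cG; subst n.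
move=> le_mu T /Tstar_parent[r [pi [piP adjE cT cP]]].
have [|u heavy] := @heavy_vertex_of_mu R k G _ le_mu.
  by rewrite kn andbT; apply: leq_trans hk.
have [f injf adjf] := embedsG G u n0n heavy T r pi piP cT cP.
exists f => // x y /adjE[[xr ->]|[yr ->]]; first exact: adjf.
by rewrite adj_sym adjf.
Qed.
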